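(* Let $\Gamma$ be an alphabet of constants and let $E$ be a one-variable word equation with constants from $\Gamma$. If $E$ has only finitely many solutions, then $E$ has at most three solutions.
   Context: Let $X$ be a variable, $X \notin \Gamma$. A one-variable word equation (with constants) is a pair $(U, V) \in (\{X\} \cup \Gamma)^* \times (\{X\} \cup \Gamma)^*$. Its solutions are the constant-preserving monoid morphisms $h : (\{X\} \cup \Gamma)^* \to \Gamma^*$ (that is, $h(a) = a$ for all $a \in \Gamma$) such that $h(U) = h(V)$. Such a morphism is determined by the word $h(X) \in \Gamma^*$, which is allowed to be empty. *)

(* Defs.v *)
From mathcomp Require Import all_boot.
From mathcomp Require Import classical_sets functions cardinality.

Set Implicit Arguments.
Unset Strict Implicit.
Unset Printing Implicit Defensive.

(* The alphabet {X} u Gamma: None is the variable X and Some a is the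
   constant a, so X is not a constant by construction. *)
Definition letter (Gamma : Type) : Type := option Gamma.

Definition word_equation (Gamma : Type) : Type :=
  (seq (letter Gamma) * seq (letter Gamma))%type.

Definition monoid_morph (A B : Type) (h : seq A -> seq B) : Prop :=
  h [::] = [::] /\ {morph h : u v / u ++ v}.

Definition constant_preserving (Gamma : Type)
    (h : seq (letter Gamma) -> seq Gamma) : Prop :=
  forall a : Gamma, h [:: Some a] = [:: a].

(* A set of morphisms, not of words h(X): functions are compared
   extensionally, by the functional extensionality axiom, so distinct elements
   are distinct morphisms. *)
Definition solutions (Gamma : Type) (E : word_equation Gamma) :
    set (seq (letter Gamma) -> seq Gamma) :=
  [set h | [/\ monoid_morph h, constant_preserving h & h E.1 = h E.2]]%classic.

(* Main.v *)
Require Import Defs.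
From mathcomp Require Import all_boot all_order all_algebra.
From mathcomp Require Import zify ring.
From mathcomp Require Import boolp classical_sets functions cardinality.

Set Implicit Arguments.
Unset Strict Implicit.
Unset Printing Implicit Defensive.
Import Order.TTheory GRing.Theory Num.Theory.

(* Let U, V be the two sides of an equation. The heart of the matter: if U and V
   have the same constants (that is, the empty word is a solution), U <> V, and
   x1, x2, x3 are solutions with 0 < |x1| < |x2| < |x3|, then x1 x2 = x2 x1.
   So x1 and x2 are powers of one primitive word T, and two powers of T that are
   solutions force all powers of T to be solutions. Four solutions of an
   arbitrary equation reduce to this case: they are prefixes of one another, and
   replacing the variable by x0 X, with x0 the shortest of them, makes the empty
   word a solution.

   The commutation is proved by induction on |U|. If prefixes of U and V of the
   same proper length contain equally many variables, the equation splits there.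
   Otherwise U stays ahead of V, and comparing the weighted positions of letters
   in both sides gives |x2| f(x1) = |x1| f(x2) for every weight f on letters.
   For a weight f vanishing on the solutions, words are read as paths. The place
   where both sides first reach their maximal height must be the same for the
   three solutions; then either the first variable is at the maximal height of
   all variables, or the part of the equation beginning at that height is a
   shorter equation of the same kind, and the induction applies. With f and -f,
   all variables are at height 0, so letters can be decorated by their heights.
   If a, b are the first letters at which x1 x2 and x2 x1 differ and
   f = |x1|_b [a] - |x1|_a [b], erase all decorated letters except the two found
   at that place. By induction the images of x1 and x2 commute if something was
   erased, but they still differ there; and something is erased, because the
   decorated letter just before that place is a third one. *)

(** * Words with one variable *)

Definition item_word (A : Type) (x : seq A) (o : option A) : seq A :=
  if o is Some a then [:: a] else x.

Definition subst (A : Type) (x : seq A) (U : seq (option A)) : seq A :=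
  flatten [seq item_word x o | o <- U].

Definition consts (A : Type) (U : seq (option A)) : seq A := pmap id U.

Definition nvars (A : Type) (U : seq (option A)) : nat := count (fun o : option A => ~~ o) U.

Arguments subst : simpl never.
Arguments consts : simpl never.
Arguments nvars : simpl never.

Lemma subst_cat A (x : seq A) U V : subst x (U ++ V) = subst x U ++ subst x V.
Proof. by rewrite /subst map_cat flatten_cat. Qed.

Lemma consts_cat A (U V : seq (option A)) : consts (U ++ V) = consts U ++ consts V.
Proof. exact: pmap_cat. Qed.

Lemma nvars_cat A (U V : seq (option A)) : nvars (U ++ V) = nvars U + nvars V.
Proof. exact: count_cat. Qed.

Lemma subst_consS A (x : seq A) a U : subst x (Some a :: U) = a :: subst x U.
Proof. by []. Qed.

Lemma subst_consN A (x : seq A) U : subst x (None :: U) = x ++ subst x U.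
Proof. by []. Qed.

Lemma subst_cons A (x : seq A) o U :
  subst x (o :: U) = item_word x o ++ subst x U.
Proof. by []. Qed.

Lemma consts_consS A a (U : seq (option A)) : consts (Some a :: U) = a :: consts U.
Proof. by []. Qed.

Lemma consts_consN A (U : seq (option A)) : consts (None :: U) = consts U.
Proof. by []. Qed.

Lemma nvars_consS A a (U : seq (option A)) : nvars (Some a :: U) = nvars U.
Proof. by []. Qed.

Lemma nvars_consN A (U : seq (option A)) : nvars (None :: U) = (nvars U).+1.
Proof. by []. Qed.

Definition consE A := (@subst_consS A, @subst_consN A, @consts_consS A,
  @consts_consN A, @nvars_consS A, @nvars_consN A).

Lemma subst_nil A (U : seq (option A)) : subst [::] U = consts U.
Proof. by elim: U => [|[a|] U IH] //; rewrite !consE IH. Qed.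

Lemma subst_Some A (x u : seq A) : subst x (map Some u) = u.
Proof. by elim: u => //= a u IH; rewrite consE IH. Qed.

Lemma consts_Some A (u : seq A) : consts (map Some u) = u.
Proof. by elim: u => //= a u IH; rewrite consE IH. Qed.

Lemma nvars_Some A (u : seq A) : nvars (map Some u) = 0.
Proof. by elim: u. Qed.

Lemma size_subst A (x : seq A) U : size (subst x U) = size (consts U) + nvars U * size x.
Proof.
elim: U => [|[a|] U IH] //; rewrite !consE /= ?IH //.
by rewrite size_cat IH mulSn; lia.
Qed.

Lemma size_consts_nvars A (U : seq (option A)) : size U = size (consts U) + nvars U.
Proof. by elim: U => [|[a|] U IH] //; rewrite !consE /= IH; lia. Qed.

(** Replaces the variable by [y X]. If [y] solves an equation, the empty word solves the shifted
    one. *)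
Definition shift_var (A : Type) (y : seq A) (U : seq (option A)) :=
  flatten [seq if o is Some a then [:: Some a] else rcons (map Some y) None | o <- U].

Lemma subst_shift A (x y : seq A) U : subst x (shift_var y U) = subst (y ++ x) U.
Proof.
elim: U => [|[a|] U IH] //; rewrite /shift_var /= -/(shift_var _ _).
  by rewrite !consE IH.
by rewrite -cats1 -!catA subst_cat subst_Some /= !consE IH catA.
Qed.

Lemma nvars_take_mono A (U : seq (option A)) n m :
  n <= m -> nvars (take n U) <= nvars (take m U).
Proof.
move=> le_nm; rewrite -(cat_take_drop n (take m U)) take_takel // nvars_cat.
exact: leq_addr.
Qed.

Lemma nvars_take_step A (U : seq (option A)) n k :
  nvars (take (n + k) U) <= nvars (take n U) + k.
Proof.
rewrite takeD nvars_cat leq_add2l.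
apply: leq_trans (count_size _ _) _.
by rewrite size_take_min geq_minl.
Qed.

(** * Equations in which one side is ahead in variables *)

(** The indecomposable case: no cut into prefixes of the same proper length balances the variables,
    and [U] is the side that is ahead. *)
Definition leads (A : Type) (U V : seq (option A)) : Prop :=
  [/\ consts U = consts V, nvars U = nvars V, exists U', U = None :: U' &
   forall n, 0 < n < size U -> nvars (take n V) < nvars (take n U)].

Lemma leads_size A (U V : seq (option A)) : leads U V -> size U = size V.
Proof. by case=> eqb eqc _ _; rewrite !size_consts_nvars eqb eqc. Qed.

Lemma leads_weak A (U V : seq (option A)) n :
  leads U V -> nvars (take n V) <= nvars (take n U).
Proof.
move=> leadsUV; have sz := leads_size leadsUV; case: leadsUV => _ eqc _ lt.
case: (posnP n) => [->|n_gt0]; first by rewrite !take0.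
case: (ltnP n (size U)) => [lt_n|le_n]; first by rewrite ltnW // lt // n_gt0.
by rewrite !take_oversize ?eqc // -sz.
Qed.

(** If [V1] were nonempty, proper and not longer than [U1], the cut at its length would leave it
    fewer variables than [U1]. *)
Lemma leads_cmp A (U V U1 U2 V1 V2 : seq (option A)) :
  leads U V -> U = U1 ++ U2 -> V = V1 ++ V2 -> nvars U1 <= nvars V1 ->
  [\/ V1 = [::], size U1 < size V1 | size V1 = size V].
Proof.
move=> leadsUV eU eV le_c; have sz := leads_size leadsUV.
case: (leqP (size V1) (size U1)) => [le_s|]; last by constructor 2.
have [v0|v_gt0] := posnP (size V1); first by constructor 1; apply: size0nil.
have [lt_v|ge_v] := ltnP (size V1) (size V); last first.
  by constructor 3; apply/eqP; rewrite eqn_leq ge_v eV size_cat leq_addr.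
case: leadsUV => _ _ _ /(_ (size V1)); rewrite v_gt0 sz lt_v => /(_ isT).
have := nvars_take_mono U le_s.
rewrite {2}eU eV !take_size_cat //; lia.
Qed.

(** [U] collects variables faster, so the constant of a given index comes later in [U]. Otherwise
    the cut just after [c] or just before it would contradict that [U] is ahead. *)
Lemma leads_letter A (U V U1 U2 V1 V2 : seq (option A)) c c' :
  leads U V -> U = U1 ++ Some c :: U2 -> V = V1 ++ Some c' :: V2 ->
  size (consts U1) = size (consts V1) -> nvars V1 < nvars U1.
Proof.
move=> leadsUV eU eV eq_b; rewrite ltnNge; apply/negP => le_c.
have wk := leads_weak (size U1).+1 leadsUV.
have sz := leads_size leadsUV.
have cU : nvars (take (size U1).+1 U) = nvars U1.
  by rewrite eU -cat_rcons take_size_cat ?size_rcons // -cats1 nvars_cat addn0.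
have cV : nvars (take (size V1) V) = nvars V1 by rewrite eV take_size_cat.
have sU := size_consts_nvars U1; have sV := size_consts_nvars V1.
have [lt_s|ge_s] := ltnP (size U1) (size V1).
  have := nvars_take_step V (size U1).+1 (size V1 - (size U1).+1).
  by rewrite (subnKC lt_s) cV; lia.
have eq_s : size U1 = size V1 by lia.
case: leadsUV => _ _ [U' eU'] /(_ (size U1)).
have [u0|u_gt0] := posnP (size U1).
  by move: eU; rewrite eU' (size0nil u0).
have sU1 : size U = size U1 + (size U2).+1 by rewrite eU size_cat.
have cV' : nvars (take (size U1) V) = nvars V1 by rewrite eq_s.
have cU' : nvars (take (size U1) U) = nvars U1 by rewrite eU take_size_cat.
by move=> /(_ ltac:(lia)); rewrite cV' cU'; lia.
Qed.

(** A discrete intermediate value argument: each count grows by at most one per letter, so their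
    difference cannot change sign without vanishing. *)
Lemma no_cut_sign A (U V : seq (option A)) :
  (forall n, 0 < n < size U -> nvars (take n V) != nvars (take n U)) ->
  (forall n, 0 < n < size U -> nvars (take n V) < nvars (take n U)) \/
  (forall n, 0 < n < size U -> nvars (take n U) < nvars (take n V)).
Proof.
move=> neq.
have step (W1 W2 : seq (option A)) :
    (forall n, 0 < n < size U -> nvars (take n W1) != nvars (take n W2)) ->
    nvars (take 1 W1) < nvars (take 1 W2) ->
    forall n, 0 < n < size U -> nvars (take n W1) < nvars (take n W2).
  move=> ne lt1; elim=> [//|[|n] IH] // lt_n.
  have := IH ltac:(lia); have := ne n.+2 lt_n.
  have := nvars_take_step W1 n.+1 1; rewrite addn1.
  have := nvars_take_mono W2 (leqnSn n.+1); lia.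
have [le1|gt1] := leqP (size U) 1; first by left=> n; lia.
have := neq 1 ltac:(lia); rewrite neq_ltn => /orP[lt1|lt1]; [left|right].
  exact: step.
by apply: step => // n /neq; rewrite eq_sym.
Qed.

(** Prefixes of equal length with equally many variables have equally many constants, hence images
    of equal length, so all identities split. *)
Lemma cut_equal A (x : seq A) U V n : consts U = consts V -> size U = size V ->
  subst x U = subst x V -> nvars (take n V) = nvars (take n U) ->
  [/\ consts (take n U) = consts (take n V), consts (drop n U) = consts (drop n V),
      subst x (take n U) = subst x (take n V) &
      subst x (drop n U) = subst x (drop n V)].
Proof.
move=> eb es ex ec.
have sb : size (consts (take n U)) = size (consts (take n V)).
  apply/eqP; rewrite -(eqn_add2r (nvars (take n U))) -size_consts_nvars -ec -size_consts_nvars.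
  by rewrite !size_take_min es.
have eb' : consts (take n U) ++ consts (drop n U) = consts (take n V) ++ consts (drop n V).
  by rewrite -!consts_cat !cat_take_drop.
have ex' : subst x (take n U) ++ subst x (drop n U)
         = subst x (take n V) ++ subst x (drop n V).
  by rewrite -!subst_cat !cat_take_drop.
have [e1 e2] : consts (take n U) = consts (take n V) /\ consts (drop n U) = consts (drop n V).
  split; [move/(congr1 (take (size (consts (take n U))))): eb'
         |move/(congr1 (drop (size (consts (take n U))))): eb'].
    by rewrite take_size_cat // sb take_size_cat.
  by rewrite drop_size_cat // sb drop_size_cat.
have sx : size (subst x (take n U)) = size (subst x (take n V)).
  by rewrite !size_subst sb ec.
split=> //; [move/(congr1 (take (size (subst x (take n U))))): ex'
            |move/(congr1 (drop (size (subst x (take n U))))): ex'].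
  by rewrite take_size_cat // sx take_size_cat.
by rewrite drop_size_cat // sx drop_size_cat.
Qed.

(** Positions in an image are affine in the length of the solution; two affine functions that agree
    at two lengths coincide. *)
Lemma size_lin p p' c c' l l' : l != l' ->
  p + c * l = p' + c' * l -> p + c * l' = p' + c' * l' -> c = c' /\ p = p'.
Proof.
move=> ne e1 e2.
have [lt|lt|ec] := ltngtP c c'.
- have [k ek] : exists k, c' = c + k.+1 by exists (c' - c).-1; lia.
  by move: e1 e2 ne; rewrite ek !mulnDl; nia.
- have [k ek] : exists k, c = c' + k.+1 by exists (c - c').-1; lia.
  by move: e1 e2 ne; rewrite ek !mulnDl; nia.
- by move: e1; rewrite ec; lia.
Qed.

Lemma last_var A (V : seq (option A)) : 0 < nvars V ->
  exists V' r, V = rcons V' None ++ map Some r.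
Proof.
elim/last_ind: V => [//|V [a|] IH]; last by exists V, [::]; rewrite cats0.
rewrite -cats1 nvars_cat addn0 => /IH [V' [r eV]].
by exists V', (rcons r a); rewrite eV map_rcons -cats1 -[in RHS]cats1 catA.
Qed.

Lemma cat_inv A (s1 s2 t1 t2 : seq A) : size s1 = size t1 ->
  s1 ++ s2 = t1 ++ t2 -> s1 = t1 /\ s2 = t2.
Proof.
move=> es e; split.
  by move/(congr1 (take (size s1))): e; rewrite take_size_cat // es take_size_cat.
by move/(congr1 (drop (size s1))): e; rewrite drop_size_cat // es drop_size_cat.
Qed.

Lemma cat_inv_le A (s1 s2 t1 t2 : seq A) : size s1 <= size t1 ->
  s1 ++ s2 = t1 ++ t2 -> exists r, t1 = s1 ++ r /\ s2 = r ++ t2.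
Proof.
move=> le e; exists (drop (size s1) t1).
have e1 : s1 = take (size s1) t1.
  move/(congr1 (take (size s1))): e; rewrite take_size_cat // takel_cat //.
split; first by rewrite -{1}(cat_take_drop (size s1) t1) -e1.
move/(congr1 (drop (size s1))): e; rewrite drop_size_cat // drop_cat.
have [|ge] := ltnP; first by [].
have -> : size s1 = size t1 by lia.
by rewrite subnn drop0 drop_size.
Qed.

(** * Reading words by automata *)

Section Labelling.
Context {S : eqType} {A B : Type}.
Implicit Types (st : S -> A -> S) (g : S -> A -> B) (s t : S).
Implicit Types (u v x : seq A) (U V : seq (option A)).

(* [st] is the transition function of an automaton and [g] its output. In an
   equation, the automaton ignores the variables; this is faithful for solutions
   that fix every state in which a variable is read. *)
Fixpoint labels st g s u : seq B :=
  if u is c :: u' then g s c :: labels st g (st s c) u' else [::].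

Fixpoint label_eq st g s U : seq (option B) :=
  if U is o :: U' then
    if o is Some c then Some (g s c) :: label_eq st g (st s c) U'
    else None :: label_eq st g s U'
  else [::].

Fixpoint var_states st s U : seq S :=
  if U is o :: U' then
    if o is Some c then var_states st (st s c) U' else s :: var_states st s U'
  else [::].

Lemma labels_cat st g s u v :
  labels st g s (u ++ v) = labels st g s u ++ labels st g (foldl st s u) v.
Proof. by elim: u s => //= c u IH s; rewrite IH. Qed.

Lemma size_labels st g s u : size (labels st g s u) = size u.
Proof. by elim: u s => //= c u IH s; rewrite IH. Qed.

Lemma labels_take st g s u n : take n (labels st g s u) = labels st g s (take n u).
Proof. by elim: u s n => //= c u IH s [|n] //=; rewrite IH. Qed.

Lemma consts_label_eq st g s U : consts (label_eq st g s U) = labels st g s (consts U).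
Proof. by elim: U s => [|[c|] U IH] s //=; rewrite ?consE /= IH. Qed.

Lemma nvars_label_eq st g s U : nvars (label_eq st g s U) = nvars U.
Proof. by elim: U s => [|[c|] U IH] s //=; rewrite ?consE /= IH. Qed.

Lemma size_label_eq st g s U : size (label_eq st g s U) = size U.
Proof. by elim: U s => [|[c|] U IH] s //=; rewrite IH. Qed.

Lemma label_eq_cat st g s U V :
  label_eq st g s (U ++ V) = label_eq st g s U ++ label_eq st g (foldl st s (consts U)) V.
Proof. by elim: U s => [|[c|] U IH] s //=; rewrite ?consE /= ?IH. Qed.

Lemma label_eq_take st g s U n : take n (label_eq st g s U) = label_eq st g s (take n U).
Proof. by elim: U s n => [|[c|] U IH] s [|n] //=; rewrite IH. Qed.

Lemma var_states_cat st s U V :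
  var_states st s (U ++ V)
  = var_states st s U ++ var_states st (foldl st s (consts U)) V.
Proof. by elim: U s => [|[c|] U IH] s //=; rewrite ?consE /= IH. Qed.

Lemma size_var_states st s U : size (var_states st s U) = nvars U.
Proof. by elim: U s => [|[c|] U IH] s //=; rewrite ?consE /= IH. Qed.

(** Because [x] returns to every state in which a variable is read and outputs the same [y] there,
    labelling commutes with substitution. This turns a solution [x] into a solution [y] of the
    labelled equation. *)
Lemma labels_subst st g s x y U :
  {in var_states st s U, forall t, foldl st t x = t /\ labels st g t x = y} ->
  labels st g s (subst x U) = subst y (label_eq st g s U).
Proof.
elim: U s => [|[c|] U IH] s //= inv; rewrite ?consE /=; first by rewrite IH.
have [e1 e2] := inv s (mem_head _ _).
by rewrite labels_cat e1 e2 IH // => t t_in; apply: inv; rewrite inE t_in orbT.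
Qed.

Lemma foldl_subst st s x U :
  {in var_states st s U, forall t, foldl st t x = t} ->
  foldl st s (subst x U) = foldl st s (consts U).
Proof.
elim: U s => [|[c|] U IH] s //= inv; rewrite ?consE /=; first by rewrite IH.
rewrite foldl_cat inv ?mem_head // IH // => t t_in.
by apply: inv; rewrite inE t_in orbT.
Qed.

End Labelling.

Section FirstHit.
Context {S : eqType} {A : Type}.
Implicit Types (st : S -> A -> S) (P : S -> A -> bool) (s t : S).
Implicit Types (u v x : seq A) (U V : seq (option A)).

Definition hits st P s u := has id (labels st P s u).
Definition hit st P s u := find id (labels st P s u).

Lemma hits_cat st P s u v :
  hits st P s (u ++ v) = hits st P s u || hits st P (foldl st s u) v.
Proof. by rewrite /hits labels_cat has_cat. Qed.

Lemma hit_cat st P s u v :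
  hit st P s (u ++ v) =
  if hits st P s u then hit st P s u else size u + hit st P (foldl st s u) v.
Proof. by rewrite /hit /hits labels_cat find_cat size_labels. Qed.

Lemma hit_lt st P s u : hits st P s u -> hit st P s u < size u.
Proof. by rewrite /hits has_find size_labels. Qed.

Lemma first_hit st P s x U : hits st P s (subst x U) ->
  exists U1 o U2, [/\ U = U1 ++ o :: U2, ~~ hits st P s (subst x U1),
    hits st P (foldl st s (subst x U1)) (item_word x o) &
    hit st P s (subst x U) =
      size (subst x U1) + hit st P (foldl st s (subst x U1)) (item_word x o)].
Proof.
elim: U s => [|o U IH] s //; rewrite subst_cons hits_cat hit_cat.
case: ifP => /= [h _|nh /IH [U1 [o' [U2 [-> nh1 h1 ->]]]]].
  by exists [::], o, U.
exists (o :: U1), o', U2; split=> //; rewrite subst_cons ?hits_cat ?nh //.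
  by rewrite foldl_cat.
by rewrite foldl_cat size_cat addnA.
Qed.

Lemma hits_subst st P s x U :
  {in var_states st s U, forall t, foldl st t x = t} ->
  hits st P s (subst x U) =
  hits st P s (consts U) || has (fun t => hits st P t x) (var_states st s U).
Proof.
elim: U s => [|[c|] U IH] s //= inv; rewrite ?consE.
  by rewrite [LHS]/hits /= -/(hits st P (st s c) _) IH // orbA.
rewrite hits_cat inv ?mem_head // IH; last first.
  by move=> t t_in; apply: inv; rewrite inE t_in orbT.
by rewrite orbCA.
Qed.

Lemma count_subst st P s x U : (forall t, foldl st t x = t) ->
  count id (labels st P s (subst x U)) = count id (labels st P s (consts U))
    + sumn [seq count id (labels st P t x) | t <- var_states st s U].
Proof.
move=> inv; elim: U s => [|[c|] U IH] s //=; rewrite ?consE /=.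
  by rewrite IH addnA.
by rewrite labels_cat count_cat inv IH addnCA.
Qed.

End FirstHit.

(** * Weights of letters, heights and moments *)

Section Heights.
Context {A : Type}.
Variable f : A -> int.
Implicit Types (u v x : seq A) (U V : seq (option A)) (h : int) (Q : int -> bool).
Local Open Scope ring_scope.

Definition height h c : int := h + f c.
Definition heightP Q h c : bool := Q (h + f c).
Definition fsum u : int := \sum_(c <- u) f c.

Lemma fsum_cons c u : fsum (c :: u) = f c + fsum u.
Proof. exact: big_cons. Qed.

Lemma foldl_height h u : foldl height h u = h + fsum u.
Proof.
elim: u h => [|c u IH] h /=; first by rewrite /fsum big_nil addr0.
by rewrite IH fsum_cons /height addrA.
Qed.

Lemma labels_heightP_shift Q h u : labels height (heightP Q) h u =
  labels height (heightP (fun k => Q (h + k))) 0 u.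
Proof.
have: h = h + 0 by rewrite addr0.
move: {1 3}h => h' ->; move: (0 : int) => k.
elim: u k => //= c u IH k; rewrite /heightP /height -addrA; congr cons.
exact: IH.
Qed.

(* The moment of a substituted word depends on the number [var_letter] of pairs of
   a variable followed by a constant, which differs between [U] and [V] when one
   leads the other; this makes the weight of a solution proportional to its length. *)
Fixpoint moment u : int :=
  if u is c :: u' then f c * (size u')%:Z + moment u' else 0.

Fixpoint var_letter U : nat :=
  if U is o :: U' then (if o is None then size (consts U') else 0) + var_letter U' else 0.

Fixpoint letter_var U : int :=
  if U is o :: U' then (if o is Some c then f c * (nvars U')%:Z else 0) + letter_var U' else 0.

Lemma moment_cat u v : moment (u ++ v) = moment u + moment v + fsum u * (size v)%:Z.
Proof.
elim: u => [|c u IH] /=; first by rewrite /fsum big_nil; ring.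
by rewrite IH fsum_cons size_cat PoszD; ring.
Qed.

(** The moment adds [f c] once for every pair of [c] and a later letter. The terms collect, in
    order, the pairs of two constants, inside one copy of [x], of a copy and a later constant, of a
    constant and a later copy, and of two copies. *)
Lemma moment_subst x U :
  moment (subst x U) = moment (consts U) + (nvars U)%:Z * moment x
   + fsum x * (var_letter U)%:Z + (size x)%:Z * letter_var U
   + fsum x * (size x)%:Z * 'C(nvars U, 2)%:Z.
Proof.
elim: U => [|[c|] U IH]; first by rewrite /subst /consts /nvars /= bin0n /=; ring.
  by rewrite ?consE /= IH size_subst PoszD PoszM; ring.
by rewrite ?consE moment_cat IH size_subst /= binS bin1 !PoszD PoszM intS; ring.
Qed.

End Heights.

(** A variable is counted once for itself and once for every later letter. The later constants add
    up to [var_letter U], the rest to the binomial coefficient. *)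
Lemma var_letter_sum A (U : seq (option A)) :
  \sum_(n < (size U).+1) nvars (take n U) = var_letter U + 'C((nvars U).+1, 2).
Proof.
elim: U => [|o U IH]; first by rewrite big_ord_recl big_ord0.
rewrite big_ord_recl take0 add0n; case: o => [c|] /=.
  rewrite !consE add0n -IH; apply: eq_bigr => i _; exact: nvars_consS.
transitivity (\sum_(i < (size U).+1) (nvars (take i U) + 1)).
  by apply: eq_bigr => i _; rewrite nvars_consN addn1.
by rewrite big_split /= IH sum_nat_const card_ord muln1 !consE [in RHS]binS bin1 (size_consts_nvars U); lia.
Qed.

Lemma leads_var_letter A (U V : seq (option A)) : leads U V -> 1 < size U ->
  var_letter V < var_letter U.
Proof.
move=> leadsUV sU; have sz := leads_size leadsUV.
have: \sum_(n < (size U).+1) nvars (take n V) < \sum_(n < (size U).+1) nvars (take n U).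
  rewrite (bigD1 (inord 1)) //= [X in _ < X](bigD1 (inord 1)) //=.
  rewrite -addSn leq_add //.
    rewrite inordK; last by lia.
    by case: leadsUV => _ _ _; apply; lia.
  by apply: leq_sum => i _; apply: leads_weak.
rewrite var_letter_sum sz var_letter_sum.
by case: leadsUV => _ -> _ _; rewrite ltn_add2r.
Qed.

(** Equating the moments of the two sides leaves [fsum f x] times the nonzero difference of the
    [var_letter] equal to [size x] times a factor that does not depend on [x]. *)
Lemma proportional A (f : A -> int) (U V : seq (option A)) x y :
  leads U V -> 1 < size U -> subst x U = subst x V -> subst y U = subst y V ->
  (fsum f x * (size y)%:Z = fsum f y * (size x)%:Z)%R.
Proof.
move=> leadsUV sU ex ey; have lt := leads_var_letter leadsUV sU.
case: leadsUV => eb ec _ _.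
have := congr1 (moment f) ex; have := congr1 (moment f) ey.
rewrite !moment_subst eb ec => {}ey {}ex.
set a := var_letter U in lt ex ey; set b := var_letter V in lt ex ey.
have ne : (a%:Z - b%:Z != 0)%R by lia.
apply: (mulIf ne).
have {}ex : (fsum f x * (a%:Z - b%:Z) = (size x)%:Z * (letter_var f V - letter_var f U))%R.
  by apply/eqP; rewrite -subr_eq0; move/eqP: ex; rewrite -subr_eq0 => /eqP <-; apply/eqP; ring.
have {}ey : (fsum f y * (a%:Z - b%:Z) = (size y)%:Z * (letter_var f V - letter_var f U))%R.
  by apply/eqP; rewrite -subr_eq0; move/eqP: ey; rewrite -subr_eq0 => /eqP <-; apply/eqP; ring.
have -> : (fsum f x * (size y)%:Z * (a%:Z - b%:Z) = fsum f x * (a%:Z - b%:Z) * (size y)%:Z)%R by ring.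
have -> : (fsum f y * (size x)%:Z * (a%:Z - b%:Z) = fsum f y * (a%:Z - b%:Z) * (size x)%:Z)%R by ring.
by rewrite ex ey; ring.
Qed.

Lemma leads_cases A (U V : seq (option A)) :
  consts U = consts V -> nvars U = nvars V -> U <> V ->
  1 < size U /\
  ((exists n, 0 < n < size U /\ nvars (take n V) = nvars (take n U)) \/
   leads U V \/ leads V U).
Proof.
move=> eb ec ne; have es : size U = size V by rewrite !size_consts_nvars eb ec.
have sU : 1 < size U.
  rewrite ltnNge; apply/negP => le; apply: ne.
  case: U V eb ec es le => [|o [|? ?]] // [|o' [|? ?]] // eb ec _ _.
  by case: o o' eb ec => [a|] [b|] //; rewrite /consts /= => -[->].
have head (W1 W2 : seq (option A)) : size W1 = size U ->
    (forall n, 0 < n < size U -> nvars (take n W2) < nvars (take n W1)) ->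
    exists W', W1 = None :: W'.
  move=> sW /(_ 1 ltac:(lia)); case: W1 sW => [|[c|] W1] /=; rewrite ?take0 //.
  by move=> _ _; exists W1.
split=> //.
case: (boolP (has (fun n => nvars (take n V) == nvars (take n U)) (iota 1 (size U).-1))).
  by case/hasP => n; rewrite mem_iota => lt /eqP e; left; exists n; split=> //; lia.
move/hasPn => nc; right.
case: (@no_cut_sign A U V) => [n lt_n|lt|lt].
- by apply: nc; rewrite mem_iota; lia.
- by left; split=> //; apply: (head U V).
- by right; rewrite /leads -es; split=> //; apply: (head V U).
Qed.

(** * Solutions that are powers of one primitive word *)

Definition wpow (A : Type) (T : seq A) n := flatten (nseq n T).

Lemma size_wpow A (T : seq A) n : size (wpow T n) = n * size T.
Proof. by rewrite /wpow size_flatten /shape map_nseq sumn_nseq mulnC. Qed.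

Lemma wpowS A (T : seq A) n : wpow T n.+1 = T ++ wpow T n.
Proof. by []. Qed.

Lemma wpowD A (T : seq A) m n : wpow T (m + n) = wpow T m ++ wpow T n.
Proof. by elim: m => //= m IH; rewrite addSn !wpowS IH catA. Qed.

Lemma wpowM A (T : seq A) m n : wpow (wpow T m) n = wpow T (n * m).
Proof. by elim: n => //= n IH; rewrite wpowS IH mulSn wpowD. Qed.

(** A nonempty word is a proper power exactly when a proper rotation fixes it; rotations are what
    reading [T] from another phase produces. *)
Definition primitive (A : eqType) (T : seq A) :=
  forall r, 0 < r < size T -> rot r T != T.

Definition pos_mod (A : Type) (l : nat) (i : nat) (c : A) : nat := i.+1 %% l.

(** Compares the word read with the infinite power of [T]. For nonempty [T] the default [c] never
    matters, the index being reduced modulo the length. *)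
Definition mismatch (A : eqType) (T : seq A) (i : nat) (c : A) : bool :=
  c != nth c T (i %% size T).

(* Every variable is preceded by a multiple of [l] constants. *)
Definition aligned (A : Type) (l : nat) (U : seq (option A)) : bool :=
  all (fun t => t == 0) (var_states (@pos_mod A l) 0 U).

Section Position.
Context {A : Type}.
Variable l : nat.
Hypothesis l_gt0 : 0 < l.
Implicit Types (u x : seq A) (U V : seq (option A)).

Lemma foldl_pos_mod i u : i < l -> foldl (@pos_mod A l) i u = (i + size u) %% l.
Proof.
elim: u i => [|c u IH] i lt /=; first by rewrite addn0 modn_small.
by rewrite IH ?ltn_mod // /pos_mod modnDml addnS addSn.
Qed.

Lemma var_states_pos_mod i U : i < l -> all (fun t => t < l) (var_states (@pos_mod A l) i U).
Proof.
elim: U i => [|[c|] U IH] i lt //=; first by rewrite IH // ltn_mod.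
by rewrite lt IH.
Qed.

Lemma pos_mod_fixed i x U : i < l -> l %| size x ->
  {in var_states (@pos_mod A l) i U, forall t, foldl (@pos_mod A l) t x = t}.
Proof.
move=> lt /dvdnP[k ek] t /(allP (var_states_pos_mod U lt)) lt_t.
by rewrite foldl_pos_mod // ek addnC modnMDl modn_small.
Qed.

End Position.

Lemma var_states_shape A B l i (U : seq (option A)) (V : seq (option B)) :
  map isSome U = map isSome V ->
  var_states (@pos_mod A l) i U = var_states (@pos_mod B l) i V.
Proof.
elim: U V i => [|o U IH] [|o' V] i //= [eo eV].
by case: o o' eo => [a|] [b|] //= _; rewrite (IH V).
Qed.

Lemma aligned_shape A B l (U : seq (option A)) (V : seq (option B)) :
  map isSome U = map isSome V -> aligned l U = aligned l V.
Proof. by move=> e; rewrite /aligned (var_states_shape l 0 e). Qed.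

Lemma aligned_cat_l A l (U V : seq (option A)) : aligned l (U ++ V) -> aligned l U.
Proof. by rewrite /aligned var_states_cat all_cat => /andP[]. Qed.

Section Mismatch.
Context {A : eqType}.
Variable T : seq A.
Hypothesis T_gt0 : 0 < size T.
Implicit Types (u x : seq A) (U V : seq (option A)).
Local Notation l := (size T).
Local Notation st := (@pos_mod A l).
Local Notation hitsT := (hits st (mismatch T)).
Local Notation hitT := (hit st (mismatch T)).

Lemma hits_mismatchP i u : i < l ->
  reflect (forall c j, j < size u -> nth c u j = nth c T ((i + j) %% l)) (~~ hitsT i u).
Proof.
elim: u i => [|d u IH] i lt; first by apply: ReflectT.
rewrite [hitsT _ _]/hits /= negb_or negbK -/(hitsT _ _).
apply: (iffP andP) => [[/eqP e /IH h] c [|j] lt_j /=|h].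
- rewrite addn0 modn_small // (set_nth_default d c) //.
  by move: e; rewrite modn_small.
- by rewrite (h _ c) ?ltn_mod // modnDml addnS addSn.
split; first by have := h d 0 isT; rewrite addn0 => e; apply/eqP; exact: e.
apply/IH; first by rewrite ltn_mod.
by move=> c j lt_j; rewrite modnDml addSnnS; apply: (h c j.+1).
Qed.

Lemma nohit_unique i u v : i < l -> size u = size v ->
  ~~ hitsT i u -> ~~ hitsT i v -> u = v.
Proof.
move=> lt es /(hits_mismatchP _ lt) hu /(hits_mismatchP _ lt) hv.
case: u es hu => [|c u] es hu; first by rewrite (size0nil (esym es)).
by apply: (@eq_from_nth _ c) => // j lt_j; rewrite hu // hv // -es.
Qed.

Hypothesis T_primitive : primitive T.

Lemma hitsT0 : ~~ hitsT 0 T.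
Proof. by apply/hits_mismatchP => // c j lt; rewrite add0n modn_small. Qed.

(** Without a mismatch, [T] would be equal to [rot r T], against primitivity. *)
Lemma hitsT_pos r : 0 < r < l -> hitsT r T.
Proof.
move=> /andP[r_gt0 lt_r]; apply/negPn/negP => /(hits_mismatchP _ lt_r) h.
have := @T_primitive r; rewrite r_gt0 lt_r => /(_ isT) /eqP; apply.
case: T T_gt0 lt_r h => // c T' _ lt_r h.
apply: (@eq_from_nth _ c) => [|j lt_j]; first by rewrite size_rot.
rewrite size_rot in lt_j; rewrite h // /rot nth_cat size_drop nth_drop.
case: ltnP => ge; first by rewrite modn_small //; lia.
rewrite nth_take; last by lia.
congr nth.
have -> : r + j = (j - (size (c :: T') - r)) + size (c :: T') by lia.
by rewrite modnDr modn_small //; lia.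
Qed.

Lemma hits_wpow r n : r < l -> 0 < n -> hitsT r (wpow T n) = (r != 0).
Proof.
move=> lt_r; elim: n => // n IH _; rewrite wpowS hits_cat foldl_pos_mod // modnDr modn_small //.
have [r0|r_gt0] := posnP r; last by rewrite hitsT_pos ?r_gt0 // -lt0n r_gt0.
rewrite r0 in IH *; rewrite (negbTE hitsT0) /=.
by case: n IH => // n /(_ isT).
Qed.

Lemma hit_wpow r n : 0 < r < l -> 0 < n -> hitT r (wpow T n) = hitT r T.
Proof. by case: n => // n lt_r _; rewrite wpowS hit_cat hitsT_pos. Qed.

(** A positive power of [T] mismatches exactly in the nonzero phases, so the answer is the same for
    all positive exponents. *)
Lemma hits_wpow_subst n U : 0 < n ->
  hitsT 0 (subst (wpow T n) U) = hitsT 0 (consts U) || ~~ aligned l U.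
Proof.
move=> n_gt0; rewrite hits_subst; last first.
  by apply: pos_mod_fixed => //; rewrite size_wpow dvdn_mull.
congr (_ || _); rewrite /aligned -has_predC; apply: eq_in_has => t t_in /=.
by rewrite hits_wpow // (allP (var_states_pos_mod T_gt0 U T_gt0) t).
Qed.

Lemma aligned_None U1 U2 : aligned l (U1 ++ None :: U2) -> l %| size (consts U1).
Proof.
rewrite /aligned var_states_cat all_cat /= => /and3P[_ /eqP e _].
by move: e; rewrite foldl_pos_mod // add0n => e; apply/eqP.
Qed.

(** Place and offset of the first mismatch do not depend on the exponent: a misaligned variable
    mismatches already within its first copy of [T]. *)
Lemma first_mismatch n U : 0 < n -> hitsT 0 (subst (wpow T n) U) ->
  exists U1 o U2 off, [/\ U = U1 ++ o :: U2, ~~ hitsT 0 (consts U1) /\ aligned l U1,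
    off < l, (if o is None then ~~ (l %| size (consts U1)) else off == 0) &
    forall k, 0 < k -> hitT 0 (subst (wpow T k) U) = size (subst (wpow T k) U1) + off].
Proof.
move=> n_gt0 /first_hit [U1 [o [U2 [eU nh h _]]]].
have stE k : foldl st 0 (subst (wpow T k) U1) = size (consts U1) %% l.
  rewrite foldl_subst; first by rewrite foldl_pos_mod.
  by apply: pos_mod_fixed => //; rewrite size_wpow dvdn_mull.
have nh' k : 0 < k -> ~~ hitsT 0 (subst (wpow T k) U1).
  by move=> k_gt0; rewrite hits_wpow_subst // -(hits_wpow_subst U1 n_gt0).
have hb : ~~ hitsT 0 (consts U1) /\ aligned l U1.
  by move: nh; rewrite hits_wpow_subst // negb_or negbK => /andP.
rewrite stE in h; have lt := ltn_mod (size (consts U1)) l; rewrite T_gt0 in lt.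
case: o eU h => [c|] eU h; last first.
  rewrite /= hits_wpow // in h.
  have lt' : 0 < size (consts U1) %% l < l by rewrite lt0n h lt.
  exists U1, None, U2, (hitT (size (consts U1) %% l) T); split=> //.
    by apply: hit_lt; apply: hitsT_pos.
  move=> k k_gt0; rewrite eU subst_cat hit_cat (negbTE (nh' _ k_gt0)) stE.
  by rewrite consE hit_cat hits_wpow // h hit_wpow.
exists U1, (Some c), U2, 0; split=> // k k_gt0.
rewrite eU subst_cat hit_cat (negbTE (nh' _ k_gt0)) stE consE.
by rewrite -cat1s hit_cat h /hit /=; move: h; rewrite /hits /= orbF => ->.
Qed.

End Mismatch.

Lemma leads_takeS A (U V U1 V1 U2 V2 : seq (option A)) c :
  leads U V -> U = U1 ++ Some c :: U2 -> V = V1 ++ None :: V2 ->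
  nvars U1 = nvars V1 -> size U1 < size V1.
Proof.
move=> leadsUV eU eV ec; rewrite ltnNge; apply/negP => le.
have := leads_weak (size V1).+1 leadsUV.
have -> : nvars (take (size V1).+1 V) = (nvars V1).+1.
  by rewrite eV -cat_rcons take_size_cat ?size_rcons // -cats1 nvars_cat addn1.
have : nvars (take (size V1).+1 U) <= nvars U1.
  have -> : nvars U1 = nvars (take (size U1).+1 U).
    by rewrite eU -cat_rcons take_size_cat ?size_rcons // -cats1 nvars_cat addn0.
  exact: nvars_take_mono.
lia.
Qed.

(* Two solutions [T^a] and [T^b] force the variables to sit at multiples of [|T|],
   up to the first misaligned variable of [U]; that one overlaps the last
   aligned variable of [V] by less than [|T|]. *)
Lemma aligned_prefix (A : eqType) (T : seq A) (U V : seq (option A)) a b :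
  0 < size T -> primitive T -> leads U V -> 1 < size U -> a != b -> 0 < a -> 0 < b ->
  subst (wpow T a) U = subst (wpow T a) V -> subst (wpow T b) U = subst (wpow T b) V ->
  exists U1 U2 V1 V2, [/\ U = U1 ++ U2 /\ V = V1 ++ V2, nvars U1 = nvars V1 /\ 0 < nvars U1,
    aligned (size T) U1 /\ aligned (size T) V1,
    ~~ hits (@pos_mod A (size T)) (mismatch T) 0 (consts V1) /\ size T %| size (consts V1) &
    U2 = [::] /\ V2 = [::] \/
    size U1 < size V1 < size U1 + size T /\ exists U3, U2 = None :: U3].
Proof.
move=> T0 Tp leadsUV sU ne a0 b0 ea eb; have sz := leads_size leadsUV.
have [eb0 ec [U' eU'] D] := leadsUV.
have cU0 : 0 < nvars U by rewrite eU'.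
case: (boolP (hits (@pos_mod A (size T)) (mismatch T) 0 (subst (wpow T a) U))) => [h|nh]; last first.
  move: (nh); rewrite hits_wpow_subst // negb_or negbK => /andP[nhU alU].
  move: (nh); rewrite ea hits_wpow_subst // negb_or negbK => /andP[nhV alV].
  exists U, [::], V, [::]; rewrite !cats0; split=> //; last by left.
  split=> //; have [V' [r eV]] : exists V' r, V = rcons V' None ++ map Some r.
    by apply: last_var; rewrite -ec.
  (* A constant at the end of [V] would put all variables of [V] before the last proper cut, where
     [U] is strictly ahead. *)
  have r0 : r = [::].
    case: r eV => // c r eV.
    have := D (size U).-1; rewrite ltn_predL => /(_ ltac:(lia)).
    have := nvars_take_mono U (leq_pred (size U)); rewrite take_size ec.
    have -> : nvars (take (size U).-1 V) = nvars V; last by lia.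
    have eW : V = (rcons V' None ++ map Some (belast c r)) ++ [:: Some (last c r)].
      by rewrite eV lastI map_rcons -(cats1 (map _ _)) catA.
    rewrite sz eW size_cat addn1 /= take_size_cat // [RHS]nvars_cat.
    by rewrite nvars_consS addn0.
  move: eV; rewrite r0 cats0 => eV.
  have -> : consts V = consts V' by rewrite eV -cats1 consts_cat cats0.
  by apply: (@aligned_None _ _ T0 V' [::]); rewrite -?cats1 cats1 -eV.
have h' : hits (@pos_mod A (size T)) (mismatch T) 0 (subst (wpow T a) V) by rewrite -ea.
have [U1 [o [U2 [off [eU [nhU alU] lo ho hU]]]]] := first_mismatch T0 Tp a0 h.
have [V1 [o' [V2 [off' [eV [nhV alV] lo' ho' hV]]]]] := first_mismatch T0 Tp a0 h'.
have := hU b b0; rewrite eb hV // !size_subst; have := hU a a0; rewrite ea hV // !size_subst => e1 e2.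
(* The position of the first mismatch is the same on both sides, for both exponents, and affine in
   the length of the solution. *)
have [ecn elen] : nvars U1 = nvars V1 /\ size (consts U1) + off = size (consts V1) + off'.
  have ne' : size (wpow T a) != size (wpow T b) by rewrite !size_wpow eqn_pmul2r.
  by apply: (size_lin ne'); lia.
(* [U] cannot mismatch first at a constant: [leads_letter] excludes this against a constant of [V],
   [leads_takeS] against a variable. *)
case: o eU ho => [c|] eU ho.
  have off0 : off = 0 by apply/eqP.
  case: o' eV ho' => [c'|] eV ho'.
    have off0' : off' = 0 by apply/eqP.
    have := leads_letter leadsUV eU eV ltac:(lia); lia.
  have := leads_takeS leadsUV eU eV ecn.
  by rewrite !size_consts_nvars ecn; lia.
have U1n : nvars U1 > 0.
  case: U1 eU ho {nhU alU hU e1 e2 ecn elen} => [|[c|] U1] eU; rewrite ?dvdn0 //.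
  by move: eU'; rewrite eU.
have [V' [r eV1]] : exists V' r, V1 = rcons V' None ++ map Some r.
  by apply: last_var; rewrite -ecn.
(* Cutting [V1] after its last variable makes the number of constants a multiple of [size T]. *)
set Vc := rcons V' None in eV1.
have cVc : nvars Vc = nvars V1 by rewrite eV1 nvars_cat nvars_Some addn0.
have alVc : aligned (size T) Vc by apply: aligned_cat_l (map Some r) _; rewrite -eV1.
have dVc : size T %| size (consts Vc).
  have -> : consts Vc = consts V' by rewrite /Vc -cats1 consts_cat cats0.
  by apply: (@aligned_None _ _ T0 V' [::]); rewrite cats1.
have bV1 : consts V1 = consts Vc ++ r by rewrite eV1 consts_cat consts_Some.
have sVc := size_consts_nvars Vc; have sU1 := size_consts_nvars U1.
have lt1 : size U1 < size Vc.
  have eV' : V = Vc ++ (map Some r ++ o' :: V2) by rewrite catA -eV1.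
  case: (leads_cmp leadsUV eU eV'); rewrite ?cVc ?ecn //.
    by move=> e; move: U1n; rewrite ecn -cVc e.
  by rewrite eV' !size_cat /=; lia.
exists U1, (None :: U2), Vc, (map Some r ++ o' :: V2); split=> //.
- by rewrite catA -eV1.
- by rewrite cVc.
- split=> //; move: nhV; rewrite bV1 hits_cat negb_or => /andP[] //.
- right; split; last by exists U2.
  rewrite lt1 /=; have := congr1 size bV1; rewrite size_cat; lia.
Qed.

(** Induction on the length. Without a balanced cut, [aligned_prefix] either shows that both images
    follow the infinite power of [T], or cuts the equation into two shorter ones with solutions
    [wpow T a] and [wpow T b]: [U1 z = V1] and [U2 = z V2], where the word of constants [z] is the
    same for both exponents. *)
Lemma pump (A : eqType) (T : seq A) a b : 0 < size T -> primitive T ->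
  a != b -> 0 < a -> 0 < b -> forall U V, consts U = consts V -> nvars U = nvars V ->
  subst (wpow T a) U = subst (wpow T a) V -> subst (wpow T b) U = subst (wpow T b) V ->
  forall n, subst (wpow T n) U = subst (wpow T n) V.
Proof.
move=> T0 Tp ne a0 b0 U; have [N] := ubnP (size U).
elim: N U => // N IH U lt_N V eb ec ea eb' n.
have [->//|/eqP neUV] := eqVneq U V.
have [sU [[m [lt_m cut]]|leadsUV]] := leads_cases eb ec neUV.
  have es : size U = size V by rewrite !size_consts_nvars eb ec.
  have [b1 b2 a1 a2] := cut_equal eb es ea cut.
  have [_ _ a1' a2'] := cut_equal eb es eb' cut.
  have ec2 : nvars (drop m U) = nvars (drop m V).
    by have := ec; rewrite -{1}(cat_take_drop m U) -{1}(cat_take_drop m V) !nvars_cat; lia.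
  rewrite -(cat_take_drop m U) -(cat_take_drop m V) !subst_cat.
  rewrite (IH (take m U) _ (take m V)) ?size_take_min //; last by lia.
  by rewrite (IH (drop m U) _ (drop m V)) ?size_drop //; lia.
have main (W1 W2 : seq (option A)) : size W1 = size U -> leads W1 W2 ->
    subst (wpow T a) W1 = subst (wpow T a) W2 ->
    subst (wpow T b) W1 = subst (wpow T b) W2 ->
    subst (wpow T n) W1 = subst (wpow T n) W2.
  move=> sW leadsW ea1 eb1; rewrite -sW in lt_N sU.
  move: ea1 eb1 => {U V eb ec ea eb' neUV leadsUV sW} ea eb.
  have [U1 [U2 [V1 [V2 [[eU eV] [ec c0] [alU alV] [nh dv] cases]]]]] :=
    aligned_prefix T0 Tp leadsW sU ne a0 b0 ea eb.
  have [ebW ecW _ _] := leadsW; have szW := leads_size leadsW.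
  case: cases => [[U20 V20]|[/andP[lt1 lt2] [U3 eU2]]].
    have [->|n0] := posnP n; first by rewrite !subst_nil.
    move: eU eV; rewrite U20 V20 !cats0 => eU eV; subst W1 W2.
    apply: (nohit_unique T0 (i := 0)); rewrite ?T0 //; first by rewrite !size_subst ebW ecW.
      by rewrite hits_wpow_subst // negb_or negbK alU andbT ebW.
    by rewrite hits_wpow_subst // negb_or negbK alV andbT.
  have sU1 := size_consts_nvars U1; have sV1 := size_consts_nvars V1.
  have [z [ez ez2]] : exists z, consts V1 = consts U1 ++ z /\ consts U2 = z ++ consts V2.
    by apply: cat_inv_le; [lia | rewrite -!consts_cat -eU -eV].
  have sz : size z = size V1 - size U1.
    by move: (congr1 size ez); rewrite size_cat; lia.
  have zT k : 0 < k -> subst (wpow T k) W1 = subst (wpow T k) W2 ->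
      subst (wpow T k) V1 = subst (wpow T k) U1 ++ z /\
      subst (wpow T k) U2 = z ++ subst (wpow T k) V2.
    move=> k0 ek.
    have [r [er er2]] : exists r, subst (wpow T k) V1 = subst (wpow T k) U1 ++ r /\
        subst (wpow T k) U2 = r ++ subst (wpow T k) V2.
      apply: cat_inv_le; last by rewrite -!subst_cat -eU -eV.
      by rewrite !size_subst ec; lia.
    (* The overlap [r] of the images and the overlap [z] of the constants have equal length and are
       read from the same phase without mismatch. *)
    suff erz : r = z by rewrite -erz.
    have sr : size r = size z.
      by move: (congr1 size er); rewrite size_cat !size_subst ec; lia.
    apply: (nohit_unique T0 (i := size (consts U1) %% size T)) => //.
    - by rewrite ltn_mod.
    - have : ~~ hits (@pos_mod A (size T)) (mismatch T) 0 (subst (wpow T k) V1).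
        by rewrite hits_wpow_subst // negb_or negbK alV andbT.
      rewrite er hits_cat negb_or => /andP[_]; rewrite foldl_pos_mod // add0n size_subst.
      by rewrite size_wpow mulnA addnC modnMDl.
    - by move: nh; rewrite ez hits_cat negb_or => /andP[_]; rewrite foldl_pos_mod.
  have c1 k : 0 < k -> subst (wpow T k) W1 = subst (wpow T k) W2 ->
      subst (wpow T k) (U1 ++ map Some z) = subst (wpow T k) V1 /\
      subst (wpow T k) U2 = subst (wpow T k) (map Some z ++ V2).
    by move=> k0 /(zT k k0) [e1 e2]; rewrite !subst_cat !subst_Some -e1 -e2.
  have [ea1 ea2] := c1 a a0 ea; have [eb1 eb2] := c1 b b0 eb.
  have cU2 : 0 < nvars U2 by rewrite eU2.
  have cUV2 : nvars U2 = nvars V2 by move: ecW; rewrite eU eV !nvars_cat; lia.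
  have sU2 := size_consts_nvars U2; have sV2 := size_consts_nvars V2.
  have sWU : size W1 = size U1 + size U2 by rewrite eU size_cat.
  have sWV : size W2 = size V1 + size V2 by rewrite eV size_cat.
  have e1 : subst (wpow T n) (U1 ++ map Some z) = subst (wpow T n) V1.
    apply: IH => //; first by rewrite size_cat size_map; lia.
      by rewrite consts_cat consts_Some ez.
    by rewrite nvars_cat nvars_Some addn0.
  have e2 : subst (wpow T n) U2 = subst (wpow T n) (map Some z ++ V2).
    apply: IH => //; first by lia.
      by rewrite consts_cat consts_Some.
    by rewrite nvars_cat nvars_Some.
  rewrite eU eV !subst_cat e2 -e1 !subst_cat catA //.
case: leadsUV => leadsUV; first exact: main.
by apply/esym/main => //; rewrite !size_consts_nvars eb ec.
Qed.

(** Euclid's algorithm on the lengths: the longer word begins with the shorter one, and the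
    remainder commutes with the shorter one. The bound on [T] makes the descent in [primitive_root]
    terminate. *)
Lemma common_power (A : eqType) (u v : seq A) : u ++ v = v ++ u ->
  0 < size u -> 0 < size v -> exists T a b, [/\ u = wpow T a, v = wpow T b & size T <= size u].
Proof.
have [n] := ubnP (size u + size v); elim: n u v => // n IH u v lt_n e u0 v0.
have [lt|lt|es] := ltngtP (size u) (size v).
- have [w [ev eu]] := cat_inv_le (ltnW lt) e.
  have sw : size v = size u + size w by rewrite ev size_cat.
  have e' : u ++ w = w ++ u by rewrite -ev -eu.
  have [T [a [b [eT1 eT2 le]]]] := IH u w ltac:(lia) e' u0 ltac:(lia).
  by exists T, a, (a + b); rewrite wpowD -eT1 -eT2.
- have [w [eu ev]] := cat_inv_le (ltnW lt) (esym e).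
  have su : size u = size v + size w by rewrite eu size_cat.
  have e' : w ++ v = v ++ w by rewrite -eu -ev.
  have [T [a [b [eT1 eT2 le]]]] := IH w v ltac:(lia) e' ltac:(lia) v0.
  by exists T, (b + a), b; rewrite wpowD -eT1 -eT2; split=> //; lia.
have [-> _] := cat_inv es e.
by exists v, 1, 1; rewrite /wpow /= cats0.
Qed.

(** If a proper rotation fixes [T], its two parts commute, so [T] is a power of a shorter word. *)
Lemma primitive_root (A : eqType) (T : seq A) : 0 < size T ->
  exists R k, [/\ 0 < size R, primitive R & T = wpow R k].
Proof.
have [n] := ubnP (size T); elim: n T => // n IH T lt_n T0.
case: (boolP (has (fun r => rot r T == T) (iota 1 (size T).-1))) => [|/hasPn np].
  case/hasP => r; rewrite mem_iota => lt_r /eqP rT.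
  have e : take r T ++ drop r T = drop r T ++ take r T by rewrite cat_take_drop -/(rot r T) rT.
  have st : size (take r T) = r by rewrite size_take; case: ifP; lia.
  have [R [a [b [e1 e2 le]]]] := common_power e ltac:(rewrite st; lia) ltac:(rewrite size_drop; lia).
  have R0 : 0 < size R.
    by rewrite lt0n; apply/eqP => R0; move: st; rewrite e1 size_wpow R0; lia.
  have [S [k [S0 Sp eR]]] := IH R ltac:(lia) R0.
  exists S, ((a + b) * k); split=> //.
  by rewrite -(cat_take_drop r T) e1 e2 -wpowD eR wpowM.
exists T, 1; rewrite /wpow /= cats0; split=> // r lt_r; apply: np.
by rewrite mem_iota; lia.
Qed.

Lemma comm_primitive (A : eqType) (u v : seq A) : u ++ v = v ++ u ->
  0 < size u -> 0 < size v ->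
  exists T a b, [/\ 0 < size T, primitive T, u = wpow T a & v = wpow T b].
Proof.
move=> e u0 v0; have [T [a [b [eu ev le]]]] := common_power e u0 v0.
have T0 : 0 < size T by move: u0; rewrite eu size_wpow; lia.
have [R [k [R0 Rp eT]]] := primitive_root T0.
by exists R, (a * k), (b * k); rewrite eu ev eT !wpowM.
Qed.

(** * Where both sides first reach their maximal height *)

Section MaxHeight.
Context {A : Type}.
Variable f : A -> int.
Local Open Scope ring_scope.

Definition height_ge (L : int) : int -> A -> bool := heightP f (fun k => L <= k).

(** [M] is the maximal height after a nonempty prefix of [x]. It is stated for all starting heights
    since the copies of [x] are read from different ones. *)
Definition is_max (x : seq A) (M : int) :=
  forall h L, hits (height f) (height_ge L) h x = (L <= h + M).

Lemma is_max_exists x : (0 < size x)%N -> exists M, is_max x M.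
Proof.
elim: x => // c [|d x] IH _.
  by exists (f c) => h L; rewrite /hits /= orbF.
have [M HM] := IH isT; exists (Num.max (f c) (f c + M)) => h L.
rewrite -cat1s hits_cat HM {1}/hits /= orbF /height_ge /heightP /height -addrA.
by rewrite addr_maxr le_max.
Qed.

Definition top_at (t : int) (U1 U : seq (option A)) :=
  [/\ exists U2, U = U1 ++ None :: U2, t \notin var_states (height f) 0 U1 &
      foldl (height f) 0 (consts U1) = t].

Lemma top_in t U1 U2 : foldl (height f) 0 (consts U1) = t ->
  t \in var_states (height f) 0 (U1 ++ None :: U2).
Proof. by move=> e; rewrite var_states_cat mem_cat e /= mem_head orbT. Qed.

Lemma top_at_prefix t U1 U W o R : top_at t U1 U -> U = W ++ o :: R ->
  t \notin var_states (height f) 0 W -> (size W <= size U1)%N.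
Proof.
move=> [[U2 eU] nt et] eW nW; rewrite leqNgt; apply/negP => lt.
have [r [eW' _]] : exists r, W = rcons U1 None ++ r /\ U2 = r ++ (o :: R).
  by apply: cat_inv_le; rewrite ?size_rcons // cat_rcons -eU.
by move: nW; rewrite eW' cat_rcons top_in.
Qed.

Lemma top_at_unique t U1 U1' U : top_at t U1 U -> top_at t U1' U -> U1 = U1'.
Proof.
move=> h1 h2; have [[U2 e1] n1 _] := h1; have [[U2' e2] n2 _] := h2.
have := top_at_prefix h1 e2 n2; have := top_at_prefix h2 e1 n1 => le1 le2.
have [] := @cat_inv _ U1 (None :: U2) U1' (None :: U2') _ _ => //; first by lia.
by rewrite -e1.
Qed.

Lemma letter_unique (V V1 V2 V1' V2' : seq (option A)) c c' :
  V = V1 ++ Some c :: V2 -> V = V1' ++ Some c' :: V2' ->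
  size (consts V1) = size (consts V1') -> V1 = V1'.
Proof.
have half (W1 W2 W1' W2' : seq (option A)) d d' : W1 ++ Some d :: W2 = W1' ++ Some d' :: W2' ->
    size (consts W1) = size (consts W1') -> (size W1' <= size W1)%N.
  move=> e es; rewrite leqNgt; apply/negP => lt.
  have [r [eW _]] : exists r, W1' = rcons W1 (Some d) ++ r /\ W2 = r ++ Some d' :: W2'.
    by apply: cat_inv_le; rewrite ?size_rcons // cat_rcons.
  by move: es; rewrite eW cat_rcons consts_cat size_cat consE /=; lia.
move=> e1 e2 es; have e : V1 ++ Some c :: V2 = V1' ++ Some c' :: V2' by rewrite -e1.
have := half _ _ _ _ _ _ e es; have := half _ _ _ _ _ _ (esym e) (esym es) => le1 le2.
by have [] := @cat_inv _ V1 (Some c :: V2) V1' (Some c' :: V2') _ e; first lia.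
Qed.

End MaxHeight.

Lemma eq_labels (S : eqType) (A B : Type) (st : S -> A -> S) (g g' : S -> A -> B) s u :
  (forall t c, g t c = g' t c) -> labels st g s u = labels st g' s u.
Proof. by move=> e; elim: u s => //= c u IH s; rewrite e IH. Qed.

Lemma max_int (s : seq int) : (0 < size s)%N ->
  exists2 m, m \in s & {in s, forall y, (y <= m)%R}.
Proof.
elim: s => // c [|d s] IH _.
  by exists c => [|y]; rewrite inE // => /eqP->.
have [m m_in le] := IH isT; have [le_cm|lt] := leP c m.
  by exists m => [|y]; rewrite inE ?m_in ?orbT // => /orP[/eqP->|/le].
exists c => [|y]; rewrite inE ?eqxx // => /orP[/eqP->//|/le le_y].
exact: le_trans le_y (ltW lt).
Qed.

Lemma sumn_map_gt0 (T : eqType) (F : T -> nat) s t : t \in s -> 0 < F t ->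
  0 < sumn [seq F i | i <- s].
Proof.
elim: s => //= a s IH; rewrite inE => /orP[/eqP->|/IH h /h]; lia.
Qed.

Lemma sumn_map_eq0 (T : eqType) (F : T -> nat) s : {in s, forall t, F t = 0} ->
  sumn [seq F i | i <- s] = 0.
Proof.
elim: s => //= a s IH z; rewrite z ?mem_head // IH // => t t_in.
by rewrite z // inE t_in orbT.
Qed.

Section Top.
Context {A : Type}.
Variable f : A -> int.
Local Open Scope ring_scope.
Local Notation st := (height f).
Local Notation states := (var_states (height f) 0).
Local Notation H L h u := (hits (height f) (height_ge f L) h u).
Local Notation ht L h u := (hit (height f) (height_ge f L) h u).

Lemma foldl_zero x t : fsum f x = 0 -> foldl st t x = t.
Proof. by rewrite foldl_height => ->; rewrite addr0. Qed.

Lemma hit_shift t M x : ht (t + M) t x = ht M 0 x.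
Proof.
rewrite /hit /height_ge labels_heightP_shift; congr find; apply: eq_labels => s c.
by rewrite /heightP lerD2l.
Qed.

Lemma hits_letter L (V1 V2 : seq (option A)) c : L <= foldl st 0 (consts V1) + f c ->
  H L 0 (consts (V1 ++ Some c :: V2)).
Proof.
by move=> le; rewrite consts_cat hits_cat consE {2}/hits /= /height_ge /heightP le orbT.
Qed.

(** Only a variable at the top height [t] can reach [L] inside. So [L] is first reached in the first
    such variable, or at a constant before it. *)
Lemma visit_word x M t L (W : seq (option A)) : fsum f x = 0 -> is_max f x M ->
  t \in states W -> {in states W, forall s, s <= t} -> L = t + M ->
  (exists W1, [/\ top_at f t W1 W, ~~ H L 0 (consts W1) &
     ht L 0 (subst x W) = (size (subst x W1) + ht M 0%R x)%N]) \/
  (exists W1 c W2, [/\ W = W1 ++ Some c :: W2, t \notin states W1,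
     ~~ H L 0 (consts W1), L <= foldl st 0 (consts W1) + f c &
     ht L 0 (subst x W) = size (subst x W1)]).
Proof.
move=> x0 Mx t_in t_max eL.
have inv U : {in states U, forall s, foldl st s x = s} by move=> s _; exact: foldl_zero.
have hW : H L 0 (subst x W).
  by rewrite hits_subst // orbC; apply/orP; left; apply/hasP; exists t; rewrite ?Mx ?eL.
have [W1 [o [W2 [eW nh h1 eh]]]] := first_hit hW.
rewrite foldl_subst // in h1 eh.
have := nh; rewrite hits_subst // negb_or => /andP[nhb /hasPn nhs].
have nt : t \notin states W1.
  by apply/negP => /nhs; rewrite Mx eL lexx.
case: o eW h1 eh => [c|] eW h1 eh.
  right; exists W1, c, W2; split=> //; last by rewrite eh /hit /=; move: h1;
    rewrite /hits /= orbF => ->; rewrite addn0.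
  by move: h1; rewrite /hits /= orbF.
left; exists W1.
have et : foldl st 0 (consts W1) = t.
  apply/eqP; rewrite eq_le; apply/andP; split; first by apply: t_max; rewrite eW top_in.
  by move: h1; rewrite /= Mx eL lerD2r.
split=> //; first by split=> //; exists W2.
by rewrite eh et eL hit_shift.
Qed.

Context {U V : seq (option A)}.
Hypothesis leadsUV : leads U V.

(** If the highest variable of one side were above all variables of the other, the level it reaches
    would be attained inside variables on one side only. The constants attain it equally often on
    both sides, so the images would differ. *)
Lemma common_top x M : fsum f x = 0 -> is_max f x M -> subst x U = subst x V ->
  exists t, [/\ t \in states U, t \in states V, {in states U, forall s, s <= t} &
    {in states V, forall s, s <= t}].
Proof.
move=> x0 Mx ex; have [eb ec [U' eU] _] := leadsUV.
have inv t : foldl st t x = t by exact: foldl_zero.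
have cU : (0 < nvars U)%N by rewrite eU.
have [tU tU_in tU_max] : exists2 m, m \in states U & {in states U, forall y, y <= m}.
  by apply: max_int; rewrite size_var_states.
have [tV tV_in tV_max] : exists2 m, m \in states V & {in states V, forall y, y <= m}.
  by apply: max_int; rewrite size_var_states -ec.
have lt_false (W1 W2 : seq (option A)) t1 t2 : consts W1 = consts W2 ->
    subst x W1 = subst x W2 -> t1 \in states W1 -> {in states W2, forall y, y <= t2} ->
    t2 < t1 -> False.
  move=> eb' ex' t1_in t2_max lt.
  have := congr1 (fun w => count id (labels st (height_ge f (t1 + M)) 0 w)) ex'.
  rewrite /= !count_subst // eb' => /eqP; rewrite eqn_add2l => /eqP e.
  have z : sumn [seq count id (labels st (height_ge f (t1 + M)) t x) | t <- states W2] = 0%N.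
    apply: sumn_map_eq0 => y /t2_max le; apply/eqP; rewrite -leqn0 leqNgt -has_count.
    have := Mx y (t1 + M); rewrite /hits => ->.
    by rewrite lerD2r -ltNge (le_lt_trans le).
  suff : (0 < sumn [seq count id (labels st (height_ge f (t1 + M)) t x) | t <- states W1])%N.
    by rewrite e z.
  apply: sumn_map_gt0 t1_in _; rewrite -has_count.
  by have := Mx t1 (t1 + M); rewrite /hits => ->.
have [lt|lt|e] := ltgtP tU tV.
- by case: (@lt_false V U tV tU).
- by case: (@lt_false U V tU tV).
- by exists tU; rewrite {2}e; split=> //; move=> s /tV_max; rewrite e.
Qed.

Lemma letter_pos L (W W1 W2 : seq (option A)) c : W = W1 ++ Some c :: W2 ->
  ~~ H L 0 (consts W1) -> L <= foldl st 0 (consts W1) + f c ->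
  ht L 0 (consts W) = size (consts W1).
Proof.
move=> -> nh le; rewrite consts_cat hit_cat (negbTE nh) consE -cat1s hit_cat.
have h : H L (foldl st 0 (consts W1)) [:: c] by rewrite /hits /= orbF.
by rewrite h /hit /=; move: h; rewrite /hits /= orbF => ->; rewrite addn0.
Qed.

Lemma letter_split p (W : seq (option A)) : (p < size (consts W))%N ->
  exists W1 c W2, W = W1 ++ Some c :: W2 /\ size (consts W1) = p.
Proof.
elim: W p => [|[c|] W IH] p //; rewrite ?consE.
  case: p => [|p] /= lt; first by exists [::], c, W.
  by have [W1 [d [W2 [-> <-]]]] := IH p lt; exists (Some c :: W1), d, W2.
by move=> /IH [W1 [d [W2 [-> <-]]]]; exists (None :: W1), d, W2.
Qed.

(** Both constants are the first one at level [L] in the common word of constants, so they have the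
    same index. Then more variables precede the one in [U], and the images before them differ in
    length. *)
Lemma letter_letter x L (U1 U2 V1 V2 : seq (option A)) c c' :
  (0 < size x)%N -> U = U1 ++ Some c :: U2 -> V = V1 ++ Some c' :: V2 ->
  ~~ H L 0 (consts U1) -> L <= foldl st 0 (consts U1) + f c ->
  ~~ H L 0 (consts V1) -> L <= foldl st 0 (consts V1) + f c' ->
  size (subst x U1) = size (subst x V1) -> False.
Proof.
move=> x_gt0 eU eV nU leU nV leV; rewrite !size_subst => es.
have eb : size (consts U1) = size (consts V1).
  rewrite -(letter_pos eU nU leU) -(letter_pos eV nV leV).
  by case: leadsUV => ->.
by have := leads_letter leadsUV eU eV eb; nia.
Qed.

Section Visit.
Context {x : seq A} {M t : int}.
Hypotheses (x_gt0 : (0 < size x)%N) (x0 : fsum f x = 0) (Mx : is_max f x M).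
Hypotheses (ex : subst x U = subst x V).
Hypotheses (tU : t \in states U) (tV : t \in states V).
Hypotheses (tU_max : {in states U, forall s, s <= t}).
Hypotheses (tV_max : {in states V, forall s, s <= t}).

(** A level above [t + M] is reached at constants only, so both first visits would be at constants,
    which [letter_letter] excludes. *)
Lemma not_higher L : t + M < L -> ~~ H L 0 (consts U).
Proof.
move=> lt; apply/negP => h.
have inv W : {in states W, forall s, foldl st s x = s} by move=> s _; exact: foldl_zero.
have first (W : seq (option A)) : consts W = consts U -> {in states W, forall s, s <= t} ->
    exists W1 c W2, [/\ W = W1 ++ Some c :: W2, ~~ H L 0 (consts W1),
      L <= foldl st 0 (consts W1) + f c & ht L 0 (subst x W) = size (subst x W1)].
  move=> eb W_max.
  have : H L 0 (subst x W) by rewrite hits_subst // eb h.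
  case/first_hit => W1 [o [W2 [eW nh h1 eh]]].
  rewrite foldl_subst // in h1 eh.
  move: nh; rewrite hits_subst // negb_or => /andP[nhb _].
  case: o eW h1 eh => [c|] eW h1 eh.
    exists W1, c, W2; split=> //; first by move: h1; rewrite /hits /= orbF.
    by rewrite eh /hit /=; move: h1; rewrite /hits /= orbF => ->; rewrite addn0.
  move: h1; rewrite /= Mx leNgt => /negP[]; apply: le_lt_trans lt.
  by rewrite lerD2r; apply: W_max; rewrite eW top_in.
have [U1 [c [U2 [eU nU leU hU]]]] := first U erefl tU_max.
have [V1 [c' [V2 [eV nV leV hV]]]] := first V (esym (let: And4 e _ _ _ := leadsUV in e)) tV_max.
by apply: (letter_letter x_gt0 eU eV nU leU nV leV); rewrite -hU -hV ex.
Qed.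

(* The maximal height [t + M] is first reached inside a variable on both sides
   ([both_var]), or inside a variable of [U] and at a constant of [V]
   ([var_letter_visit]). Each of the other two combinations is impossible, and
   among three solutions only the second one can occur, for all of them. *)
Definition both_var Ua Vb := [/\ top_at f t Ua U, top_at f t Vb V &
  size (subst x Ua) = size (subst x Vb)].

Definition var_letter_visit Ua Vm := exists c Vr,
  [/\ top_at f t Ua U /\ ~~ H (t + M) 0 (consts Ua), V = Vm ++ Some c :: Vr,
    t \notin states Vm /\ ~~ H (t + M) 0 (consts Vm),
    t + M <= foldl st 0 (consts Vm) + f c &
    (size (subst x Ua) + ht M 0%R x)%N = size (subst x Vm)].

Lemma visit_cases :
  (exists Ua Vb, both_var Ua Vb) \/ (exists Ua Vm, var_letter_visit Ua Vm).
Proof.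
have [eb _ _ _] := leadsUV.
have [[Ua [topa na ha]]|[U1 [c [U2 [eU nt nU leU hU]]]]] := visit_word x0 Mx tU tU_max erefl;
have [[Vb [topb nb hb]]|[V1 [c' [V2 [eV nt' nV leV hV]]]]] := visit_word x0 Mx tV tV_max erefl.
- left; exists Ua, Vb; split=> //; apply/eqP; rewrite -(eqn_add2r (ht M 0%R x)).
  by rewrite -ha -hb ex.
- by right; exists Ua, V1, c', V2; split=> //; rewrite -ha -hV ex.
(* A constant in [U] against a variable in [V]: the constant of [V] with the same index comes after
   that variable, so [U1] has at least two variables more than [Vb]. This is too much, as the offset
   inside the variable is below [size x]. *)
- exfalso; have hp := letter_pos eU nU leU.
  have hx : H M 0 x by rewrite Mx add0r.
  have := hit_lt hx.
  have := congr1 (fun w => ht (t + M) 0 w) ex; rewrite /= hU hb !size_subst => es lt_s.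
  have [[V2 eV] _ _] := topb.
  have lt : (size (consts U1) < size (consts V))%N.
    by rewrite -eb eU consts_cat size_cat consE /=; lia.
  have le : (size (consts Vb) <= size (consts U1))%N.
    rewrite -hp eb eV consts_cat hit_cat (negbTE nb); exact: leq_addr.
  have [|V3 [d [V4 [eV2 eb3]]]] := @letter_split (size (consts U1) - size (consts Vb)) V2.
    by move: lt; rewrite eV consts_cat size_cat consE; lia.
  have eV' : V = (Vb ++ None :: V3) ++ Some d :: V4 by rewrite eV eV2 -catA.
  have := leads_letter leadsUV eU eV' ltac:(rewrite consts_cat size_cat consE; lia).
  rewrite nvars_cat consE => ltc.
  have [k ek] : exists k, nvars U1 = (nvars Vb + 2 + k)%N.
    by exists (nvars U1 - nvars Vb - 2)%N; lia.
  by move: es; rewrite ek !mulnDl; lia.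
- by exfalso; apply: (letter_letter x_gt0 eU eV nU leU nV leV); rewrite -hU -hV ex.
Qed.

End Visit.

End Top.

Section Agree.
Context {A : eqType} {f : A -> int} {U V : seq (option A)} {t : int}.
Hypotheses (leadsUV : leads U V) (sU : 1 < size U).
Local Open Scope ring_scope.
Local Notation st := (height f).
Local Notation states := (var_states (height f) 0).
Local Notation H L h u := (hits (height f) (height_ge f L) h u).
Local Notation ht L h u := (hit (height f) (height_ge f L) h u).
Hypotheses (tU_max : {in states U, forall s, s <= t}).
Hypotheses (tV_max : {in states V, forall s, s <= t}).

(** By [size_lin] the cuts before and after the two top variables are both balanced, and since
    [1 < size U] one of them is proper and nonempty. *)
Lemma two_both x y Ua Vb Ua' Vb' : size x != size y ->
  both_var (U := U) (V := V) (x := x) (t := t) f Ua Vb ->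
  both_var (U := U) (V := V) (x := y) (t := t) f Ua' Vb' -> False.
Proof.
move=> ne [tUa tVb e1] [tUa' tVb' e2].
rewrite -(top_at_unique tUa tUa') -(top_at_unique tVb tVb') in e2.
move: e1 e2; rewrite !size_subst => e1 e2.
have [ec eb] := size_lin ne e1 e2.
have es : size Ua = size Vb by rewrite !size_consts_nvars ec eb.
have [[U2 eU] _ _] := tUa; have [[V2 eV] _ _] := tVb.
have sz := leads_size leadsUV.
have sV : (size V = size Vb + (size V2).+1)%N by rewrite eV size_cat.
have [v0||] := leads_cmp leadsUV eU eV ltac:(rewrite ec //); [|by rewrite es ltnn|by lia].
have eU' : U = rcons Ua None ++ U2 by rewrite cat_rcons.
have eV' : V = rcons Vb None ++ V2 by rewrite cat_rcons.
have [||] := leads_cmp leadsUV eU' eV' ltac:(rewrite -!cats1 !nvars_cat ec //).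
- by rewrite v0.
- by rewrite !size_rcons es ltnn.
- by rewrite v0 /= => e; move: sU; rewrite sz -e.
Qed.

(** By [not_higher] each of the two maxima bounds the other. Then both solutions visit the same
    variable and the same constant, with the same offset because [x] is a prefix of [y], and
    [size_lin] applies. *)
Lemma two_letter x y Mx My Ua Vm Ua' Vm' :
  (0 < size x)%N -> (size x < size y)%N -> prefix x y ->
  fsum f x = 0 -> fsum f y = 0 -> is_max f x Mx -> is_max f y My ->
  subst x U = subst x V -> subst y U = subst y V ->
  var_letter_visit (U := U) (V := V) (x := x) (M := Mx) (t := t) f Ua Vm ->
  var_letter_visit (U := U) (V := V) (x := y) (M := My) (t := t) f Ua' Vm' ->
  [/\ Mx = My, nvars Ua = nvars Vm & (size (consts Ua) + ht Mx 0%R x = size (consts Vm))%N].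
Proof.
move=> x_gt0 lt_xy pxy x0 y0 Hx Hy ex ey
  [c [Vr [[tUa na] eV [nt nb] le es]]] [c' [Vr' [[tUa' na'] eV' [nt' nb'] le' es']]].
have y_gt0 : (0 < size y)%N by lia.
have [eb _ _ _] := leadsUV.
have hx : H (t + Mx) 0 (consts U) by rewrite eb eV hits_letter.
have hy : H (t + My) 0 (consts U) by rewrite eb eV' hits_letter.
have eM : Mx = My.
  have [lt|lt|//] := ltgtP Mx My.
    by have := not_higher leadsUV x_gt0 x0 Hx ex tU_max tV_max (L := t + My);
       rewrite ltrD2l lt hy => /(_ isT).
  by have := not_higher leadsUV y_gt0 y0 Hy ey tU_max tV_max (L := t + Mx);
     rewrite ltrD2l lt hx => /(_ isT).
subst My; split=> //.
  all: have eUa := top_at_unique tUa tUa'.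
  all: have eVm : Vm = Vm' by
    apply: (letter_unique eV eV'); rewrite -(letter_pos eV nb le) -(letter_pos eV' nb' le').
  all: have ehit : ht Mx 0 y = ht Mx 0 x by
    have [w ->] := prefixP pxy; rewrite hit_cat Hx add0r lexx.
  all: subst Ua' Vm'; move: es es'; rewrite ehit !size_subst => e1 e2.
  all: have ne : size x != size y by rewrite ltn_eqF.
  all: have [] := @size_lin (size (consts Ua) + ht Mx 0%R x) (size (consts Vm)) (nvars Ua) (nvars Vm) _ _ ne
    ltac:(lia) ltac:(lia); by [].
Qed.

(** The constant [c] precedes the first variable of [V] at height [t], so the image of [Vb] is
    longer than that of [Ua]. *)
Lemma letter_both z Ua Vm Vb c Vr s :
  V = Vm ++ Some c :: Vr -> t \notin states Vm ->
  nvars Ua = nvars Vm -> (size (consts Ua) + s = size (consts Vm))%N ->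
  size (subst z Ua) = size (subst z Vb) -> top_at f t Vb V -> False.
Proof.
move=> eV nt ec es; rewrite !size_subst => e tVb.
have le := top_at_prefix tVb eV nt; have [[V2 eV2] _ _] := tVb.
have [r [eVb er]] : exists r, Vb = Vm ++ r /\ Some c :: Vr = r ++ None :: V2.
  by apply: cat_inv_le => //; rewrite -eV.
case: r eVb er => [//|o r] eVb [eo _]; subst o.
move: e; rewrite eVb consts_cat nvars_cat size_cat !consE ec /= mulnDl; lia.
Qed.

End Agree.

Section Step.
Context {A : eqType} {f : A -> int} {U V : seq (option A)} {x1 x2 x3 : seq A}.
Hypotheses (leadsUV : leads U V) (sU : 1 < size U).
Hypotheses (x1_gt0 : 0 < size x1) (lt12 : size x1 < size x2) (lt23 : size x2 < size x3).
Hypotheses (p12 : prefix x1 x2) (p23 : prefix x2 x3).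
Local Open Scope ring_scope.
Hypotheses (z1 : fsum f x1 = 0) (z2 : fsum f x2 = 0) (z3 : fsum f x3 = 0).
Hypotheses (e1 : subst x1 U = subst x1 V) (e2 : subst x2 U = subst x2 V)
  (e3 : subst x3 U = subst x3 V).
Local Notation st := (height f).
Local Notation states := (var_states (height f) 0).
Local Notation H L h u := (hits (height f) (height_ge f L) h u).
Local Notation ht L h u := (hit (height f) (height_ge f L) h u).

Lemma heights_agree : exists M t Ua Ur Vm c Vr,
  [/\ [/\ is_max f x1 M, is_max f x2 M & is_max f x3 M],
   [/\ U = Ua ++ None :: Ur, foldl st 0 (consts Ua) = t, t \notin states Ua &
     ~~ H (t + M) 0 (consts Ua)],
   [/\ V = Vm ++ Some c :: Vr, t \notin states Vm, ~~ H (t + M) 0 (consts Vm) &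
     t + M <= foldl st 0 (consts Vm) + f c],
   [/\ {in states U, forall s, s <= t}, {in states V, forall s, s <= t} & 
     forall L, t + M < L -> ~~ H L 0 (consts U)] &
   nvars Ua = nvars Vm /\ (size (consts Ua) + ht M 0%R x1)%N = size (consts Vm)].
Proof.
have x2_gt0 : (0 < size x2)%N by lia.
have x3_gt0 : (0 < size x3)%N by lia.
have [M1 H1] := is_max_exists f x1_gt0.
have [M2 H2] := is_max_exists f x2_gt0.
have [M3 H3] := is_max_exists f x3_gt0.
have [t [tU tV tUm tVm]] := common_top leadsUV z1 H1 e1.
have p13 : prefix x1 x3 := prefix_trans p12 p23.
have lt13 : (size x1 < size x3)%N by lia.
have ne12 : size x1 != size x2 by rewrite ltn_eqF.
have ne13 : size x1 != size x3 by rewrite ltn_eqF.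
have ne23 : size x2 != size x3 by rewrite ltn_eqF.
have ne21 : size x2 != size x1 by rewrite eq_sym.
have V1 := visit_cases leadsUV x1_gt0 z1 H1 e1 tU tV tUm tVm.
have V2 := visit_cases leadsUV x2_gt0 z2 H2 e2 tU tV tUm tVm.
have V3 := visit_cases leadsUV x3_gt0 z3 H3 e3 tU tV tUm tVm.
have LL12 := two_letter leadsUV sU tUm tVm x1_gt0 lt12 p12 z1 z2 H1 H2 e1 e2.
have LL13 := two_letter leadsUV sU tUm tVm x1_gt0 lt13 p13 z1 z3 H1 H3 e1 e3.
have LL23 := two_letter leadsUV sU tUm tVm x2_gt0 lt23 p23 z2 z3 H2 H3 e2 e3.
have LB (y : seq A) My z Ua Vm Ua' Vb : var_letter_visit (U := U) (V := V) (x := y) (M := My) (t := t) f Ua Vm ->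
    both_var (U := U) (V := V) (x := z) (t := t) f Ua' Vb ->
    nvars Ua = nvars Vm -> (size (consts Ua) + ht My 0%R y = size (consts Vm))%N -> False.
  move=> [c [Vr [[tUa _] eV [nt _] _ _]]] [tUa' tVb es] ec eb.
  rewrite -(top_at_unique tUa tUa') in es.
  exact: (letter_both sU eV nt ec eb es tVb).
(* Two visits of kind [both_var] exclude each other, and a single one is excluded by the two others
   through [LB]. Only three visits of kind [var_letter_visit] remain. *)
case: V1 => [[Ua1 [Vb1 B1]]|[Ua1 [Vm1 L1]]]; case: V2 => [[Ua2 [Vb2 B2]]|[Ua2 [Vm2 L2]]];
  case: V3 => [[Ua3 [Vb3 B3]]|[Ua3 [Vm3 L3]]];
  try (by case: (two_both leadsUV sU ne12 B1 B2)); try (by case: (two_both leadsUV sU ne13 B1 B3));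
  try (by case: (two_both leadsUV sU ne23 B2 B3)).
- by have [_ ec eb] := LL23 _ _ _ _ L2 L3; case: (LB _ _ _ _ _ _ _ L2 B1).
- by have [_ ec eb] := LL13 _ _ _ _ L1 L3; case: (LB _ _ _ _ _ _ _ L1 B2).
- by have [_ ec eb] := LL12 _ _ _ _ L1 L2; case: (LB _ _ _ _ _ _ _ L1 B3).
have [eM12 ec eb] := LL12 _ _ _ _ L1 L2; have [eM13 _ _] := LL13 _ _ _ _ L1 L3.
subst M2 M3.
have [c [Vr [[[[Ur eU] nt et] na] eV [nt' nb] le _]]] := L1.
exists M1, t, Ua1, Ur, Vm1, c, Vr; split=> //; split=> //.
by move=> L; apply: (not_higher leadsUV x1_gt0 z1 H1 e1 tUm tVm).
Qed.

End Step.

Lemma size_consts_shape A (U : seq (option A)) : size (consts U) = count id (map isSome U).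
Proof. by elim: U => [|[a|] U IH] //; rewrite consE /= IH. Qed.

Lemma nvars_shape A (U : seq (option A)) : nvars U = count negb (map isSome U).
Proof. by rewrite /nvars count_map; apply: eq_count; case. Qed.

Lemma shape_label_eq (S : eqType) A B st (g : S -> A -> B) s U :
  map isSome (label_eq st g s U) = map isSome U.
Proof. by elim: U s => [|[a|] U IH] s //=; rewrite IH. Qed.

Lemma count_subst_consts A (p : pred A) y U :
  count p (subst y U) = count p (consts U) + nvars U * count p y.
Proof.
elim: U => [|[a|] U IH] //; rewrite !consE; first by rewrite /= IH addnA.
by rewrite count_cat IH mulSn; lia.
Qed.

Lemma nohits_nseq (l : seq bool) : ~~ has id l -> l = nseq (size l) false.
Proof. by elim: l => //= b l IH; rewrite negb_or => /andP[/negbTE -> /IH <-]. Qed.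

(** * Counting aligned occurrences of a block *)

Section Blocks.
Context {A : eqType}.
Variables (l s : nat) (sg : seq A).
Hypotheses (l_gt0 : 0 < l) (le_sl : s <= l).
Implicit Types (u v x z : seq A).

Definition window u j := take s (drop (j * l) u).
(** Only complete blocks of length [l] count, and of each only its first [s] letters are compared
    with [sg]. *)
Definition blocks u := count (fun j => window u j == sg) (iota 0 (size u %/ l)).

Lemma blocks_cat u v : l %| size u -> blocks (u ++ v) = blocks u + blocks v.
Proof.
case/dvdnP => k ek; rewrite /blocks size_cat ek divnMDl // mulnK //.
rewrite iotaD count_cat; congr (_ + _).
  apply: eq_in_count => j; rewrite mem_iota /= add0n => lt.
  rewrite /window drop_cat ek ltn_mul2r l_gt0 lt takel_cat // size_drop ek.
  rewrite -mulnBl; apply: leq_trans le_sl _; rewrite leq_pmull // subn_gt0 //.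
rewrite -[k in iota k _]addn0 add0n iotaDl count_map; apply: eq_count => j /=.
by rewrite /window drop_cat ek mulnDl ltnNge leq_addr /= addKn.
Qed.

(** Every variable stands at a multiple of [l], so inserting [x] adds its blocks and moves the later
    ones without breaking them. *)
Lemma blocks_subst p x U z :
  l %| size x -> all (fun t => t == 0) (var_states (@pos_mod A l) (size p %% l) U) ->
  blocks (p ++ subst x U ++ z) = blocks (p ++ consts U ++ z) + nvars U * blocks x.
Proof.
move=> dx; elim: U p => [|[c|] U IH] p; rewrite ?consE.
- by rewrite addn0.
- move=> al; rewrite /= in al; rewrite -!cat_rcons IH // size_rcons.
  by move: al; rewrite /pos_mod -addn1 modnDml addn1.
rewrite /=; case/andP => /eqP p0 al; have dp : l %| size p by apply/eqP.
have := IH p al; rewrite -catA (blocks_cat _ dp) (blocks_cat _ dp) (blocks_cat _ dp) (blocks_cat _ dx).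
by rewrite mulSn; lia.
Qed.

(* [u] and [v] agree on all aligned windows except possibly the first. *)
Lemma blocks_first u v sh X K J : size u = J * l -> size v = J * l -> 0 < J ->
  size sh = s -> size sg = s -> take K u = sh ++ X -> take K v = sg ++ X ->
  J.-1 * l + s <= K -> K <= J * l -> blocks u = blocks v -> sh = sg.
Proof.
move=> eu ev J0 ssh ssg tu tv le_K le_KJ.
have win w (h : seq A) j : size w = J * l -> size h = s -> take K w = h ++ X ->
    j < J -> window w j = if j == 0 then h else take s (drop (j * l - s) X).
  move=> sw sh' tw lt_j.
  have le_jK : j * l + s <= K.
    by apply: leq_trans le_K; rewrite leq_add2r leq_mul2r; apply/orP; right; lia.
  have -> : window w j = take s (drop (j * l) (take K w)).
    by rewrite /window !take_drop take_takel //; lia.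
  rewrite tw drop_cat sh'; case: (posnP j) => [->|j0].
    rewrite mul0n /=; case: ltnP => [s0|s0]; first by rewrite drop0 take_size_cat.
    have s00 : s = 0 by lia.
    by rewrite s00 !take0 (size0nil (etrans sh' s00)).
  have -> : (j * l < s) = false by apply/negbTE; rewrite -leqNgt (leq_trans le_sl) // leq_pmull.
  by [].
rewrite /blocks eu ev mulnK // -(prednK J0) /=.
rewrite (win u sh 0) // (win v sg 0) // eqxx => /eqP.
have -> : count (fun j => window u j == sg) (iota 1 J.-1)
        = count (fun j => window v j == sg) (iota 1 J.-1).
  apply: eq_in_count => j; rewrite mem_iota => lt_j /=.
  have lt_jJ : j < J by lia.
  have j0 : (j == 0) = false by apply/eqP; lia.
  by rewrite (win u sh j) // (win v sg j) // j0.
by rewrite eqn_add2r eqxx; case: (sh =P sg).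
Qed.

End Blocks.

Lemma take_overlap A (x u v w1 w2 : seq A) d : u ++ x ++ w1 = v ++ w2 ->
  size v = size u + d -> d <= size x -> v = u ++ take d x.
Proof.
move=> e sv le; have [r [ev er]] : exists r, v = u ++ r /\ x ++ w1 = r ++ w2.
  by apply: cat_inv_le => //; rewrite sv leq_addr.
have sr : size r = d by move: sv; rewrite ev size_cat; lia.
rewrite ev; congr (_ ++ _); move/(congr1 (take d)): er.
by rewrite takel_cat // take_size_cat // sr.
Qed.

(** * The equation that starts at the maximal height *)

Section TopBlock.
Context {A : eqType} {f : A -> int} {mu : int}.
Local Open Scope ring_scope.
Local Notation st := (height f).
Local Notation states := (var_states (height f) 0).
Local Notation low := (heightP f (fun k => k < mu)).

(** Says that [mu] is the minimal height after a nonempty prefix of [x]: read from [h], the word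
    falls below [mu] exactly if [h] is negative. *)
Definition low_iff_neg (x : seq A) :=
  fsum f x = 0 /\ forall h, hits st low h x = (h < 0).

(** Variables at nonnegative height never fall below [mu], whichever solution is inserted. So place
    and offset of the first fall are the same for all solutions that extend [x]. *)
Lemma first_low x (W : seq (option A)) : low_iff_neg x ->
  hits st low 0 (subst x W) -> exists W1 o W2 off,
  [/\ W = W1 ++ o :: W2, {in states W1, forall s, 0 <= s},
    (if o is None then (off < size x)%N /\ foldl st 0 (consts W1) < 0 else off = 0%N) &
    forall y, low_iff_neg y -> prefix x y ->
      hit st low 0 (subst y W) = (size (subst y W1) + off)%N].
Proof.
move=> [x0 Lx] hW.
have inv z U : fsum f z = 0 -> {in states U, forall s, foldl st s z = s}.
  by move=> z0 s _; exact: foldl_zero.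
have [W1 [o [W2 [eW nh h1 eh]]]] := first_hit hW.
rewrite foldl_subst // in h1 eh; last exact: inv.
have nhy y : low_iff_neg y -> ~~ hits st low 0 (subst y W1).
  move=> [y0 Ly]; move: nh; rewrite !hits_subst //; try exact: inv.
  by rewrite !(eq_has (Ly : _ =1 _)) (eq_has (Lx : _ =1 _)).
exists W1, o, W2, (hit st low (foldl st 0 (consts W1)) (item_word x o)); split=> //.
- move=> s s_in; rewrite leNgt -Lx; move: nh; rewrite hits_subst; last exact: inv.
  by rewrite negb_or => /andP[_ /hasPn /(_ s s_in)].
- case: o eW h1 eh => [c|] eW h1 eh; last by split; [exact: hit_lt | rewrite -Lx].
  by move: h1; rewrite /hits /hit /= orbF => ->.
move=> y Ly pxy; rewrite eW subst_cat hit_cat (negbTE (nhy y Ly)).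
rewrite foldl_subst; last by case: Ly => y0 _; exact: inv.
congr (_ + _)%N; rewrite subst_cons hit_cat.
case: o eW h1 eh => [c|] eW h1 eh /=; first by rewrite h1.
have [w ->] := prefixP pxy; rewrite hits_cat h1 /= hit_cat h1 //.
Qed.

Context {M : int} {UU W : seq (option A)} {x1 x2 : seq A}.
Hypotheses (ecn : nvars UU = nvars W) (es : size UU = size W).
Hypotheses (UU_None : exists U', UU = None :: U').
Hypotheses (D : forall n, (0 < n < size UU)%N -> (nvars (take n W) < nvars (take n UU))%N).
Hypotheses (L1 : low_iff_neg x1) (L2 : low_iff_neg x2).
Hypotheses (p12 : prefix x1 x2) (x1_gt0 : (0 < size x1)%N) (lt12 : (size x1 < size x2)%N).
Hypotheses (e1 : subst x1 UU = subst x1 W) (e2 : subst x2 UU = subst x2 W).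
Hypotheses (UU_max : {in states UU, forall s, s <= 0}).
Hypotheses (W_max : {in states W, forall s, s <= 0}).

(* Cutting where the level [mu] is first crossed leaves pieces [U1], [Vc] whose
   variables are all at height 0; they overlap by a prefix of length [d] of the
   variable that follows [U1]. *)
Lemma top_block : exists U1 U2 Vc V2 d,
  [/\ UU = U1 ++ U2 /\ W = Vc ++ V2, nvars U1 = nvars Vc /\ (0 < nvars U1)%N,
   (size U1 + d = size Vc)%N /\ (d < size x1)%N,
   {in states U1, forall s, s = 0} /\ {in states Vc, forall s, s = 0} &
   [/\ forall n, (0 < n < size Vc)%N -> (nvars (take n Vc) < nvars (take n U1))%N,
     (0 < d)%N -> foldl st 0 (consts U1) < 0 &
     forall y, subst y UU = subst y W -> (size x1 <= size y)%N ->
       subst y Vc = subst y U1 ++ take d y]].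
Proof.
have sz0 x : low_iff_neg x -> forall U, ~~ hits st low 0 (subst x U) ->
    {in states U, forall s, 0 <= s}.
  move=> [x0 Lx] U; rewrite hits_subst; last by move=> s _; exact: foldl_zero.
  by rewrite negb_or => /andP[_ /hasPn h] s /h; rewrite Lx leNgt.
have [U' eUU] := UU_None.
(* If the level is never crossed, all variables are at height 0, and the whole equation is taken
   with empty overlap. *)
case: (boolP (hits st low 0 (subst x1 UU))) => [h|nh]; last first.
  exists UU, [::], W, [::], 0%N; rewrite !cats0 addn0; split=> //.
  - by split=> //; rewrite eUU.
  - have nhW : ~~ hits st low 0 (subst x1 W) by rewrite -e1.
    split=> s s_in; apply/eqP; rewrite eq_le.
      by rewrite UU_max // (sz0 x1 L1 UU nh).
    by rewrite W_max // (sz0 x1 L1 W nhW).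
  - by split=> // [n lt_n|y e _]; [apply: D; rewrite es | rewrite take0 cats0 e].
have h' : hits st low 0 (subst x1 W) by rewrite -e1.
have [U1 [o [U2 [off [eU gU ho hU]]]]] := first_low L1 h.
have [V1 [o' [V2 [off' [eV gV ho' hV]]]]] := first_low L1 h'.
have := hU x2 L2 p12; rewrite e2 (hV x2 L2 p12) !size_subst.
have := hU x1 L1 (prefix_refl _); rewrite e1 (hV x1 L1 (prefix_refl _)) !size_subst.
move=> E1 E2; have ne12 : size x1 != size x2 by rewrite ltn_eqF.
have [ec eb] : nvars U1 = nvars V1 /\ (size (consts U1) + off = size (consts V1) + off')%N.
  by apply: (size_lin ne12); lia.
have c1 : (0 < nvars U1)%N.
  case: U1 eU {ec eb hU gU E1 E2} ho => [|[c|] U1] eU ho //; last by move: eUU; rewrite eU.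
  by move: eU ho; rewrite eUU /= => -[<- _] [_]; rewrite ltxx.
have [V' [r eV1]] : exists V' r, V1 = rcons V' None ++ map Some r.
  by apply: last_var; rewrite -ec.
set Vc := rcons V' None in eV1.
have cVc : nvars Vc = nvars V1 by rewrite eV1 nvars_cat nvars_Some addn0.
have bV1 : consts V1 = consts Vc ++ r by rewrite eV1 consts_cat consts_Some.
have sVc := size_consts_nvars Vc; have sU1 := size_consts_nvars U1.
have eV' : W = Vc ++ (map Some r ++ o' :: V2) by rewrite catA -eV1.
have U1_pos : (0 < size U1)%N by lia.
have sUU : size UU = (size U1 + (size U2).+1)%N by rewrite eU size_cat.
have lt1 : (size U1 < size Vc)%N.
  rewrite ltnNge; apply/negP => le; have := D (n := size U1) ltac:(lia).
  have := nvars_take_mono W le; rewrite {1}eV' eU !take_size_cat //; lia.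
have dle : (size Vc - size U1 <= off)%N.
  by have := congr1 size bV1; rewrite size_cat; lia.
(* At a constant [off] would be 0, but [Vc] is longer than [U1] by a positive amount that is at most
   [off]. *)
case: o eU ho => [c|] eU ho; first by lia.
case: ho => lt_off neg.
exists U1, (None :: U2), Vc, (map Some r ++ o' :: V2), (size Vc - size U1)%N; split=> //.
- by rewrite cVc.
- by split; lia.
- split=> s s_in; apply/eqP; rewrite eq_le.
    by rewrite gU // UU_max // eU var_states_cat mem_cat s_in.
  rewrite gV; last by rewrite eV1 var_states_cat mem_cat s_in.
  by rewrite W_max // eV' var_states_cat mem_cat s_in.
split=> //.
- move=> n /andP[n0 lt_n].
  have sW : size W = (size Vc + size (map Some r ++ o' :: V2))%N by rewrite {1}eV' size_cat.
  have [le|lt] := leqP n (size U1).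
    have := D (n := n) ltac:(lia); rewrite eV' eU takel_cat ?takel_cat //; lia.
  rewrite (take_oversize (ltnW lt)) ec -cVc /Vc -cats1 takel_cat; last first.
    by move: lt_n; rewrite /Vc size_rcons.
  rewrite nvars_cat [nvars [:: None]]/nvars /= addn1 ltnS -{2}(take_size V').
  by apply: nvars_take_mono; move: lt_n; rewrite /Vc size_rcons.
- move=> y ey le_y; apply: (@take_overlap _ y _ _ (subst y U2) (subst y (map Some r ++ o' :: V2))).
  + by rewrite -subst_consN -!subst_cat -eU -eV'.
  + by rewrite !size_subst cVc ec; lia.
  + lia.
Qed.

End TopBlock.

Lemma shape_Some A (u : seq A) : map isSome (map Some u) = nseq (size u) true.
Proof. by elim: u => //= c u ->. Qed.

Section FirstBlock.
Context {A : eqType} {f : A -> int} {mu M : int}.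
Context {UU W Vr : seq (option A)} {x1 x2 x3 sh om : seq A} {c : A}.
Local Open Scope ring_scope.
Local Notation st := (height f).
Local Notation states := (var_states (height f) 0).
Local Notation H L h u := (hits (height f) (height_ge f L) h u).
Local Notation s := (hit (height f) (height_ge f M) 0 x1).
Local Notation sg := (take s x1).
Local Notation mk h u := (labels (height f) (height_ge f M) h u).
Hypotheses (ecn : nvars UU = nvars W) (es : size UU = size W).
Hypotheses (UU_None : exists U', UU = None :: U').
Hypotheses (D : forall n, (0 < n < size UU)%N -> (nvars (take n W) < nvars (take n UU))%N).
Hypotheses (L1 : low_iff_neg (f := f) (mu := mu) x1) (L2 : low_iff_neg (f := f) (mu := mu) x2)
  (L3 : low_iff_neg (f := f) (mu := mu) x3).
Hypotheses (p12 : prefix x1 x2) (x1_gt0 : (0 < size x1)%N) (lt12 : (size x1 < size x2)%N)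
  (lt23 : (size x2 < size x3)%N).
Hypotheses (e1 : subst x1 UU = subst x1 W) (e2 : subst x2 UU = subst x2 W)
  (e3 : subst x3 UU = subst x3 W).
Hypotheses (UU_max : {in states UU, forall s, s <= 0}).
Hypotheses (W_max : {in states W, forall s, s <= 0}).
Hypotheses (M1 : is_max f x1 M) (M2 : is_max f x2 M) (M3 : is_max f x3 M).
Hypotheses (eW : W = map Some sg ++ Some c :: Vr) (hc : M <= foldl st 0 sg + f c).
Hypotheses (bUU : consts UU = sh ++ om) (bW : consts W = sg ++ om) (ssh : size sh = s)
  (fsh : foldl st 0 sh = foldl st 0 sg) (nsh : ~~ H M 0 sh).
Hypothesis IH : forall (E F : seq (option bool)) y1 y2 y3, (size E <= size UU)%N ->
  consts E = consts F -> E <> F -> subst y1 E = subst y1 F -> subst y2 E = subst y2 F ->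
  subst y3 E = subst y3 F -> (0 < size y1 < size y2)%N -> (size y2 < size y3)%N ->
  y1 ++ y2 = y2 ++ y1.

(* Recording only which letters reach the height [M] turns the top block into an
   equation over [bool]. By induction its solutions are powers of some [T], so
   variables are aligned modulo [size T], and the aligned blocks equal to [sg]
   are equally many on both sides: as all blocks but the first coincide, the
   first ones [sh] and [sg] do too. *)
Lemma first_block_eq : sh = sg.
Proof.
have lt_s : (s < size x1)%N by apply: hit_lt; rewrite M1 add0r.
have ssg : size sg = s by rewrite size_takel // ltnW.
have [U1 [U2 [Vc [V2 [d [[eU eV] [ec c0] [sd lt_d] [zU zV] [D' dneg wd]]]]]]] :=
  top_block ecn es UU_None D L1 L2 p12 x1_gt0 lt12 e1 e2 UU_max W_max.
have sU1 := size_consts_nvars U1; have sVc := size_consts_nvars Vc.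
have [Vd eVc] : exists Vd, Vc = map Some sg ++ Some c :: Vd.
  have [lt|le] := ltnP s (size Vc).
    have [r [er _]] : exists r, Vc = rcons (map Some sg) (Some c) ++ r /\ Vr = r ++ V2.
      by apply: cat_inv_le; rewrite ?size_rcons ?size_map ?ssg // cat_rcons -eW.
    by exists r; rewrite er cat_rcons.
  have [r [er _]] : exists r, map Some sg = Vc ++ r /\ V2 = r ++ (Some c :: Vr).
    by apply: cat_inv_le; rewrite ?size_map ?ssg // -eV.
  by have := congr1 (@nvars A) er; rewrite nvars_Some nvars_cat; lia.
have bVc : consts Vc = sg ++ c :: consts Vd by rewrite eVc consts_cat consts_Some.
have sg_nomark : mk 0 sg = nseq s false.
  rewrite -labels_take (@nohits_nseq (take s _)); last first.
    by apply/negP => /find_ltn; rewrite ltnn.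
  by rewrite size_takel // size_labels ltnW.
(* The padding stands for the overlap. It is read inside a variable at negative height, hence stays
   below [M] and carries no marks. *)
set Ut := label_eq st (height_ge f M) 0 U1 ++ map Some (nseq d false).
set Vt := label_eq st (height_ge f M) 0 Vc.
have bUt : consts Ut = mk 0 (consts U1) ++ nseq d false.
  by rewrite /Ut consts_cat consts_label_eq consts_Some.
have bVt : consts Vt = mk 0 (consts Vc) by rewrite /Vt consts_label_eq.
have cUt : nvars Ut = nvars U1 by rewrite /Ut nvars_cat nvars_label_eq nvars_Some addn0.
have cVt : nvars Vt = nvars Vc by rewrite /Vt nvars_label_eq.
have sol x : fsum f x = 0 -> is_max f x M -> (size x1 <= size x)%N ->
    subst x UU = subst x W -> subst (mk 0 x) Ut = subst (mk 0 x) Vt.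
  move=> x0 Mx le ex.
  have at0 U : {in states U, forall h, h = 0} ->
      {in states U, forall h, foldl st h x = h /\ mk h x = mk 0 x}.
    by move=> z h /z ->; rewrite foldl_zero.
  rewrite /Ut /Vt subst_cat subst_Some -!(labels_subst (x := x)); try exact: at0.
  rewrite wd // labels_cat foldl_subst; last by move=> h _; exact: foldl_zero.
  congr (_ ++ _); rewrite -labels_take.
  have [d0|d_gt0] := posnP d; first by rewrite d0 take0.
  have nh : ~~ has id (mk (foldl st 0 (consts U1)) x).
    have := Mx (foldl st 0 (consts U1)) M; rewrite /hits => ->.
    by rewrite -ltNge -[X in _ < X]add0r ltrD2r dneg.
  rewrite (nohits_nseq nh) take_nseq // size_labels; lia.
have y1E : size (mk 0 x1) = size x1 by rewrite size_labels.
have eb0 : consts U1 ++ consts U2 = sh ++ om by rewrite -consts_cat -eU.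
have eb1 : consts Vc ++ consts V2 = sg ++ om by rewrite -consts_cat -eV.
have sbV : size (consts Vc) = (size (consts U1) + d)%N by lia.
(* The variables contribute equally many marks on both sides, so the constants do too. *)
have ecnt : count id (mk 0 (consts U1)) = count id (mk 0 (consts Vc)).
  have := congr1 (count id) (sol x1 (proj1 L1) M1 (leqnn _) e1).
  rewrite !count_subst_consts cUt cVt ec => /eqP; rewrite eqn_add2r => /eqP.
  by rewrite bUt bVt count_cat count_nseq mul0n addn0.
have lt_s1 : (s < size (consts U1))%N.
  rewrite ltnNge; apply/negP => le.
  have [r [er _]] : exists r, sh = consts U1 ++ r /\ consts U2 = r ++ om.
    by apply: cat_inv_le => //; rewrite ssh.
  have : ~~ has id (mk 0 (consts U1)).
    by move: nsh; rewrite er hits_cat negb_or => /andP[].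
  rewrite has_count -leqNgt leqn0 ecnt bVc labels_cat count_cat /=.
  have hc' : height_ge f M (foldl st 0 sg) c by exact: hc.
  by rewrite hc'; lia.
have [r1 [er1 er1']] : exists r, consts U1 = sh ++ r /\ om = r ++ consts U2.
  by apply: cat_inv_le => //; rewrite ssh ltnW.
have [r2 [er2 er2']] : exists r, consts Vc = sg ++ r /\ om = r ++ consts V2.
  by apply: cat_inv_le => //; rewrite ssg; lia.
have sr1 : size (consts U1) = (s + size r1)%N by rewrite er1 size_cat ssh.
have sr2 : size (consts Vc) = (s + size r2)%N by rewrite er2 size_cat ssg.
have [w [ew _]] : exists w, r2 = r1 ++ w /\ consts U2 = w ++ consts V2.
  by apply: cat_inv_le; [lia | rewrite -er1' -er2'].
have sw : size w = d by move: (congr1 size ew); rewrite size_cat; lia.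
(* [sh] and [sg] carry no marks and end at the same height, so [r1] is marked alike on both sides.
   By the equal counts no mark remains for [w], which therefore matches the padding. *)
have eb : consts Ut = consts Vt.
  rewrite bUt bVt; move: ecnt; rewrite er1 er2 ew !labels_cat fsh sg_nomark (nohits_nseq nsh) size_labels ssh.
  rewrite !count_cat -catA => ecnt; congr (_ ++ (_ ++ _)); apply/esym.
  rewrite -sw -(size_labels st (height_ge f M) (foldl st (foldl st 0 sg) r1)).
  apply: nohits_nseq; rewrite has_count; apply/negP.
  by move/addnI/eqP: ecnt; rewrite -{1}[count _ _]addn0 eqn_add2l => /eqP <-.
have lt_sVc : (s < size Vc)%N by rewrite eVc size_cat size_map ssg /= addnS ltnS leq_addr.
have sUt : size Ut = size Vt by rewrite !size_consts_nvars eb cUt cVt ec.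
have sVt : size Vt = size Vc by rewrite size_label_eq.
have [U1' eU1] : exists U1', U1 = None :: U1'.
  have [UU' eUU] := UU_None; case: (U1) eU c0 => [|o U1'] //; rewrite eUU => -[<- _] _.
  by exists U1'.
have neq : Ut <> Vt.
  rewrite /Ut /Vt eU1 eVc /= label_eq_cat; case: (sg) => [|b sg'] //.
have le_sz : (size Ut <= size UU)%N by rewrite sUt sVt es eV size_cat leq_addr.
have z1 := proj1 L1; have z2 := proj1 L2; have z3 := proj1 L3.
have t1 := sol x1 z1 M1 (leqnn _) e1.
have t2 := sol x2 z2 M2 (ltnW lt12) e2.
have t3 := sol x3 z3 M3 (ltnW (ltn_trans lt12 lt23)) e3.
have comm : mk 0 x1 ++ mk 0 x2 = mk 0 x2 ++ mk 0 x1.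
  by apply: (IH le_sz eb neq t1 t2 t3); rewrite !size_labels ?x1_gt0 ?lt12.
have [T [a [b [T0 Tp ey1 ey2]]]] := comm_primitive comm
  ltac:(rewrite size_labels; lia) ltac:(rewrite size_labels; lia).
rewrite ey1 in t1; rewrite ey2 in t2.
have sx1 : size x1 = (a * size T)%N by rewrite -size_wpow -ey1 size_labels.
have sx2 : size x2 = (b * size T)%N by rewrite -size_wpow -ey2 size_labels.
have a0 : (0 < a)%N by lia.
have b0 : (0 < b)%N by lia.
have ne_ab : a != b by apply/eqP => eab; move: lt12; rewrite sx1 sx2 eab ltnn.
have leadsT : leads Ut Vt.
  split=> //; first by rewrite cUt cVt.
    by exists (label_eq st (height_ge f M) 0 U1' ++ map Some (nseq d false)); rewrite /Ut eU1.
  move=> n lt_n; rewrite sUt sVt in lt_n; have := D' n lt_n.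
  rewrite /Ut /Vt label_eq_take nvars_label_eq take_cat size_label_eq.
  case: (ltnP n (size U1)) => [lt|le]; first by rewrite label_eq_take nvars_label_eq.
  by rewrite -map_take nvars_cat nvars_Some addn0 nvars_label_eq (take_oversize le).
have sUt1 : (1 < size Ut)%N.
  have : (0 < nvars Vd)%N by move: c0; rewrite ec eVc nvars_cat nvars_Some consE.
  by rewrite sUt sVt eVc size_cat /= (size_consts_nvars Vd); lia.
have [E1 [E2 [F1 [F2 [[eE eF] [ecE cE0] [alE alF] [nmF dvF] cases]]]]] :=
  aligned_prefix T0 Tp leadsT sUt1 ne_ab a0 b0 t1 t2.
set l := size T in T0 alE alF dvF cases *.
have hT : has id T.
  have : has id (mk 0 x1) by have := M1 0 M; rewrite /hits add0r lexx.
  by rewrite ey1; apply: contraLR => nT; elim: (a) => // k IHk; rewrite wpowS has_cat negb_or nT.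
(* The marks of [x1] spell a power of [T], so the first one lies in the first copy and [s] is
   smaller than the period. *)
have sT : s = find id T.
  by rewrite /hit ey1; case: (a) a0 => // k _; rewrite wpowS find_cat hT.
have lt_sl : (s < l)%N by rewrite sT -has_find.
have Ts : nth false T s = true by rewrite sT; exact: (nth_find false hT).
have Tbefore i : (i < s)%N -> nth false T i = false.
  by rewrite sT => lt_i; exact: before_find lt_i.
have le_lx1 : (l <= size x1)%N by rewrite sx1 leq_pmull.
(* Back to letters of [A]: [Uh], [R1] and [S1] have the shapes of [Ut], [E1] and [F1], and alignment
   depends on shapes only. *)
set Uh := U1 ++ map Some (take d x1).
have shU : map isSome Uh = map isSome Ut.
  by rewrite /Uh /Ut !map_cat shape_label_eq !shape_Some size_nseq size_takel // ltnW.
have shV : map isSome Vc = map isSome Vt by rewrite shape_label_eq.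
have sUh : size Uh = size Ut by rewrite -(size_map isSome) shU size_map.
set R1 := take (size E1) Uh; set S1 := take (size F1) Vc.
have shR1 : map isSome R1 = map isSome E1.
  by rewrite /R1 map_take shU eE map_cat take_size_cat ?size_map.
have shS1 : map isSome S1 = map isSome F1.
  by rewrite /S1 map_take shV eF map_cat take_size_cat ?size_map.
have bR1 : size (consts R1) = size (consts E1) by rewrite !size_consts_shape shR1.
have bS1 : size (consts S1) = size (consts F1) by rewrite !size_consts_shape shS1.
have cR1 : nvars R1 = nvars E1 by rewrite !nvars_shape shR1.
have cS1 : nvars S1 = nvars F1 by rewrite !nvars_shape shS1.
have alR1 : aligned l R1 by rewrite (aligned_shape l shR1).
have alS1 : aligned l S1 by rewrite (aligned_shape l shS1).
have sE1 := size_consts_nvars E1; have sF1 := size_consts_nvars F1.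
have [J eJ] : exists J, size (consts F1) = (J * l)%N by have [J ->] := dvdnP dvF; exists J.
have lt_sF : (s < size (consts F1))%N.
  have [lt|le] := ltnP s (size F1).
    have [r [er _]] : exists r, F1 = label_eq st (height_ge f M) 0 (rcons (map Some sg) (Some c)) ++ r
        /\ label_eq st (height_ge f M) (foldl st 0 (consts (rcons (map Some sg) (Some c)))) Vd = r ++ F2.
      apply: cat_inv_le; first by rewrite size_label_eq size_rcons size_map ssg.
      by rewrite -label_eq_cat cat_rcons -eVc -eF.
    rewrite er consts_cat consts_label_eq size_cat size_labels -cats1 consts_cat consts_Some size_cat ssg.
    by rewrite addn1 addSn ltnS leq_addr.
  have [r [er _]] : exists r, label_eq st (height_ge f M) 0 (map Some sg) = F1 ++ r
      /\ F2 = r ++ label_eq st (height_ge f M) (foldl st 0 (consts (map Some sg))) (Some c :: Vd).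
    apply: cat_inv_le; first by rewrite size_label_eq size_map ssg.
    by rewrite -label_eq_cat -eVc -eF.
  have := congr1 (@nvars bool) er; rewrite nvars_label_eq nvars_Some nvars_cat -ecE => /esym/eqP.
  by rewrite addn_eq0 => /andP[/eqP e _]; move: cE0; rewrite e.
have J0 : (0 < J)%N by case: (J) eJ => // e; move: lt_sF; rewrite e.
have eJl : (J * l = J.-1 * l + l)%N by rewrite -{1}(prednK J0) mulSn addnC.
have eUh : subst x1 Uh = subst x1 Vc by rewrite /Uh subst_cat subst_Some wd.
have nm := hits_mismatchP T0 _ T0 nmF.
(* [z] completes the constants of [R1] to [J] blocks of length [l]. The first [K] letters come from
   the constants of [U1] and contain the windows of all [J] blocks. *)
have [z [K [wz sz [KR KU Ks]]]] : exists z K, [/\ subst x1 S1 = subst x1 R1 ++ z,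
    (size (consts R1) + size z = J * l)%N &
    [/\ (K <= size (consts R1))%N, (K <= size (consts U1))%N & (J.-1 * l + s <= K)%N]].
  case: cases => [[E20 F20]|[/andP[lt1 lt2] [U3 eE2]]].
    have eE1 : E1 = Ut by rewrite eE E20 cats0.
    have eF1 : F1 = Vt by rewrite eF F20 cats0.
    have eR1 : R1 = Uh by rewrite /R1 take_oversize // eE1 sUh.
    have eS1 : S1 = Vc by rewrite /S1 take_oversize // eF1 sVt.
    exists [::], (size (consts U1)); rewrite cats0 addn0 eS1 eR1; split=> //.
      by rewrite -eR1 bR1 eE1 eb -eF1 eJ.
    split=> //; first by rewrite /Uh consts_cat size_cat leq_addr.
    (* Otherwise the mark at [s] in the last block would fall into the unmarked padding. *)
    rewrite leqNgt; apply/negP => lt.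
    have lt_J : (J.-1 * l + s < size (consts F1))%N by rewrite eJ eJl ltn_add2l.
    have := nm false _ lt_J; rewrite add0n -/l modnMDl modn_small // Ts.
    rewrite eF1 -eb bUt nth_cat size_labels ltnNge (ltnW lt) /= nth_nseq.
    by case: ifP.
  set o := (size F1 - size E1)%N.
  have lt_o : (o < l)%N by rewrite /o; move: lt1 lt2; clear; lia.
  have o_gt0 : (0 < o)%N by rewrite /o; move: lt1; clear; lia.
  have lt_EU : (size E1 < size U1)%N.
    rewrite ltnNge; apply/negP => le.
    have [r [er _]] : exists r, E1 = label_eq st (height_ge f M) 0 U1 ++ r /\
        map Some (nseq d false) = r ++ E2.
      by apply: cat_inv_le; rewrite ?size_label_eq.
    have := congr1 (@nvars bool) er; rewrite nvars_cat nvars_label_eq => er'.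
    have := congr1 (@nvars bool) eE; rewrite cUt eE2 nvars_cat consE er'; clear; lia.
  have eR1U : R1 = take (size E1) U1 by rewrite /R1 /Uh takel_cat // ltnW.
  have [R2 eR2] : exists R2, Uh = R1 ++ None :: R2.
    have : map isSome (drop (size E1) Uh) = false :: map isSome U3.
      by rewrite map_drop shU eE map_cat drop_size_cat ?size_map // eE2.
    rewrite -{2}(cat_take_drop (size E1) Uh) -/R1.
    by case: (drop _ _) => [|[//|] R2] // _; exists R2.
  have szo : size (consts F1) = (size (consts E1) + o)%N by rewrite /o; move: sE1 sF1 ecE lt1;
    clear; lia.
  have so x : size (take o x) = (if o < size x then o else size x)%N by rewrite size_take.
  exists (take o x1), (size (consts R1)); split.
  - apply: (@take_overlap _ x1 _ _ (subst x1 R2) (subst x1 (drop (size F1) Vc))).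
    + by rewrite -subst_consN -!subst_cat -eR2 cat_take_drop.
    + by rewrite !size_subst bS1 bR1 cS1 cR1 -ecE szo; clear; lia.
    + by move: lt_o le_lx1; clear; lia.
  - by rewrite so (leq_trans lt_o le_lx1) bR1 -szo.
  split=> //.
    by rewrite eR1U -{2}(cat_take_drop (size E1) U1) consts_cat size_cat leq_addr.
  have wF : subst (wpow T a) F1 = subst (wpow T a) E1 ++ take o (wpow T a).
    apply: (@take_overlap _ (wpow T a) _ _ (subst (wpow T a) U3) (subst (wpow T a) F2)).
    + by rewrite -subst_consN -!subst_cat -eE2 -eE -eF.
    + by rewrite !size_subst -ecE szo; clear; lia.
    + by rewrite size_wpow -sx1; move: lt_o le_lx1; clear; lia.
  have nhF : ~~ hits (@pos_mod bool l) (mismatch T) 0 (subst (wpow T a) F1).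
    by rewrite hits_wpow_subst // negb_or negbK alF andbT.
  have eE1s : size (consts E1) = (J.-1 * l + (l - o))%N by move: szo eJ eJl lt_o; clear; lia.
  move: nhF; rewrite wF hits_cat negb_or foldl_pos_mod // => /andP[_].
  rewrite add0n size_subst size_wpow mulnA addnC modnMDl eE1s modnMDl modn_small;
    last by move: o_gt0 lt_o; clear; lia.
  (* Otherwise the mark at [s] in the last block would lie in the overlap, at an index below [s];
     but the overlap begins like [T], which has no mark before [s]. *)
  move=> nhz; rewrite bR1 eE1s leq_add2l leqNgt; apply/negP => lt.
  have lt_lo : (l - o < l)%N by move: o_gt0 lt_o; clear; lia.
  have lt_i : (s - (l - o) < size (take o (wpow T a)))%N.
    by rewrite so size_wpow -sx1 (leq_trans lt_o le_lx1); move: lt lt_sl lt_o; clear; lia.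
  have := hits_mismatchP T0 _ lt_lo nhz false _ lt_i.
  rewrite -/l subnKC ?(ltnW lt) // modn_small // Ts nth_take; last by move: lt lt_sl lt_o; clear; lia.
  case: (a) a0 => // k _; rewrite wpowS nth_cat -/l.
  by rewrite (_ : (s - (l - o) < l)%N) ?Tbefore //; move: lt lt_sl lt_o; clear; lia.
have le_sK : (s <= K)%N by exact: leq_trans (leq_addl _ _) Ks.
have eblk : blocks l s sg (consts R1 ++ z) = blocks l s sg (consts S1).
  have dx1 : (l %| size x1)%N by rewrite sx1 dvdn_mull.
  have b1 := blocks_subst (l := l) (s := s) sg T0 (ltnW lt_sl) (p := [::]) (U := R1) z dx1.
  have b2 := blocks_subst (l := l) (s := s) sg T0 (ltnW lt_sl) (p := [::]) (U := S1) [::] dx1.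
  rewrite /= mod0n !cats0 in b1 b2.
  have := b2 alS1; rewrite wz (b1 alR1) cR1 cS1 ecE => /eqP.
  by rewrite eqn_add2r => /eqP.
apply: (blocks_first T0 (ltnW lt_sl) (X := take (K - s) r1) _ _ J0 ssh ssg _ _ Ks _ eblk).
- by rewrite size_cat sz.
- by rewrite bS1 eJ.
- have -> : take K (consts R1 ++ z) = take K (consts U1).
    rewrite takel_cat // -(takel_cat (consts (drop (size E1) Uh)) KR) -consts_cat cat_take_drop.
    by rewrite /Uh consts_cat takel_cat.
  by rewrite er1 take_cat ssh ltnNge le_sK.
- have KS : (K <= size (consts S1))%N by rewrite bS1 eJ -sz; move: KR; clear; lia.
  rewrite -(takel_cat (consts (drop (size F1) Vc)) KS) -consts_cat cat_take_drop.
  rewrite er2 ew take_cat ssg ltnNge le_sK /= takel_cat //; move: KU sr1; clear; lia.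
- by rewrite -sz; move: KR; clear; lia.
Qed.

End FirstBlock.

(** The alphabet is quantified too, since the induction passes to marks in [bool] and to letters
    decorated by heights. *)
Definition commuting_below (n : nat) := forall (B : eqType) (E F : seq (option B)) y1 y2 y3,
  size E < n -> consts E = consts F -> E <> F ->
  subst y1 E = subst y1 F -> subst y2 E = subst y2 F -> subst y3 E = subst y3 F ->
  0 < size y1 < size y2 -> size y2 < size y3 -> y1 ++ y2 = y2 ++ y1.

(** * The variables are at height at most 0 *)

Section Level.
Local Open Scope ring_scope.

Lemma labels_opp A (f : A -> int) Q h u :
  labels (height f) (heightP f Q) h u
  = labels (height (fun a => - f a)) (heightP (fun a => - f a) (fun k => Q (- k))) (- h) u.
Proof.
elim: u h => //= c u IH h; rewrite IH /heightP /height -opprD opprK; congr (_ :: _).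
Qed.

Lemma var_states_shift A (f : A -> int) t h (U : seq (option A)) :
  var_states (height f) (t + h) U = map (fun k => t + k) (var_states (height f) h U).
Proof.
elim: U h => [|[c|] U IH] h //=; last by rewrite IH.
by rewrite -IH /height addrA.
Qed.

Lemma hits_shift A (f : A -> int) t M u :
  hits (height f) (height_ge f (t + M)) t u = hits (height f) (height_ge f M) 0 u.
Proof.
rewrite /hits /height_ge labels_heightP_shift; congr has; apply: eq_labels => s c.
by rewrite /heightP lerD2l.
Qed.

Lemma fsum_opp A (f : A -> int) u : fsum (fun a => - f a) u = - fsum f u.
Proof. by rewrite /fsum sumrN. Qed.

(** The maximum for [- f] is minus the minimum for [f]. Heights are integers, so exceeding [N] means
    reaching [1 + N]. *)
Lemma low_iff_neg_max (A : eqType) (f : A -> int) x N : fsum f x = 0 ->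
  is_max (fun a => - f a) x N -> low_iff_neg (f := f) (mu := - N) x.
Proof.
move=> x0 Nx; split=> // h; rewrite /hits labels_opp.
have := Nx (- h) (1 + N); have -> : (1 + N <= - h + N) = (h < 0) by lia.
move=> <-; congr has; apply: eq_labels => k c; rewrite /height_ge /heightP; lia.
Qed.

Context {A : eqType} {f : A -> int} {U V : seq (option A)} {x1 x2 x3 : seq A}.
Hypotheses (leadsUV : leads U V) (sU : (1 < size U)%N).
Hypotheses (x1_gt0 : (0 < size x1)%N) (lt12 : (size x1 < size x2)%N) (lt23 : (size x2 < size x3)%N).
Hypotheses (p12 : prefix x1 x2) (p23 : prefix x2 x3).
Hypotheses (z1 : fsum f x1 = 0) (z2 : fsum f x2 = 0) (z3 : fsum f x3 = 0).
Hypotheses (e1 : subst x1 U = subst x1 V) (e2 : subst x2 U = subst x2 V)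
  (e3 : subst x3 U = subst x3 V).
Hypotheses (IH : commuting_below (size U)) (ncomm : x1 ++ x2 <> x2 ++ x1).
Local Notation st := (height f).

(** If the first top variable begins [U], the top height is 0. Otherwise the equation [UU = W]
    beginning there is shorter and has the same three solutions; once [first_block_eq] shows that
    its sides have the same constants, the induction makes [x1] and [x2] commute. *)
Lemma level_le0 : {in var_states st 0 U, forall s, s <= 0} /\
  {in var_states st 0 V, forall s, s <= 0}.
Proof.
have [M [t [Ua [Ur [Vm [c [Vr [[M1 M2 M3] [eU et nt na] [eV ntV nb le] [Umax Vmax _] [ec eb]]]]]]]]] :=
  heights_agree leadsUV sU x1_gt0 lt12 lt23 p12 p23 z1 z2 z3 e1 e2 e3.
have [ua0|ua_gt0] := posnP (size Ua).
  by move: et Umax Vmax; rewrite (size0nil ua0) /= => <-.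
exfalso; apply: ncomm.
have no x : fsum f x = 0 -> fsum (fun a => - f a) x = 0 by move=> x0; rewrite fsum_opp x0 oppr0.
(* Applied to [- f], the same lemma yields one minimal height for all three solutions. *)
have [N [_ [_ [_ [_ [_ [_ [[N1 N2 N3] _ _ _ _]]]]]]]] :=
  heights_agree leadsUV sU x1_gt0 lt12 lt23 p12 p23 (no _ z1) (no _ z2) (no _ z3) e1 e2 e3.
have L1 := low_iff_neg_max z1 N1; have L2 := low_iff_neg_max z2 N2.
have L3 := low_iff_neg_max z3 N3.
set s := hit (height f) (height_ge f M) 0 x1 in eb.
have lt_s : (s < size x1)%N by apply: hit_lt; rewrite M1 add0r.
set sg := take s x1.
have ssg : size sg = s by rewrite size_takel // ltnW.
have [ebUV ecUV _ Dn] := leadsUV; have szUV := leads_size leadsUV.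
set UU := None :: Ur; set W := map Some sg ++ Some c :: Vr.
have p11 : prefix x1 x1 by exact: prefix_refl.
have p13 : prefix x1 x3 := prefix_trans p12 p23.
have sol x : prefix x1 x -> subst x U = subst x V ->
    subst x Vm = subst x Ua ++ sg /\ subst x UU = subst x W.
  move=> px ex; have [w ew] := prefixP px.
  have e : subst x Vm = subst x Ua ++ sg.
    have -> : sg = take s x by rewrite ew takel_cat // ltnW.
    apply: (@take_overlap _ x _ _ (subst x Ur) (subst x (Some c :: Vr))).
    - by rewrite -subst_consN -!subst_cat -eU -eV.
    - by rewrite !size_subst ec -eb; clear; lia.
    - by rewrite ew size_cat; move: lt_s; clear; lia.
  split=> //; have : subst x Ua ++ subst x UU = subst x Ua ++ subst x W.
    by rewrite -subst_cat -eU ex eV [in LHS]subst_cat e /W subst_cat subst_Some catA.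
  by case/cat_inv.
have [wV eW1] := sol x1 p11 e1; have [_ eW2] := sol x2 p12 e2; have [_ eW3] := sol x3 p13 e3.
have fs0 x W0 : fsum f x = 0 -> foldl st 0 (subst x W0) = foldl st 0 (consts W0).
  by move=> x0; rewrite foldl_subst // => h _; exact: foldl_zero.
have fVm : foldl st 0 (consts Vm) = t + fsum f sg.
  by rewrite -(fs0 x1) // wV foldl_cat fs0 // et foldl_height.
(* [sh] is the part of the constants between the two cuts; in [W] the prefix [sg] of the solutions
   stands in its place. The sides [UU] and [W] have the same constants exactly if [sh = sg]. *)
have [sh [eVm eUr]] : exists r, consts Vm = consts Ua ++ r /\ consts Ur = r ++ (c :: consts Vr).
  apply: cat_inv_le; first by rewrite -eb leq_addr.
  by move: ebUV; rewrite eU eV !consts_cat.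
have ssh : size sh = s by move: (congr1 size eVm) eb; rewrite size_cat; clear; lia.
have fsh : foldl st 0 sh = foldl st 0 sg.
  by move: fVm; rewrite eVm foldl_cat et !foldl_height; clear; lia.
have sUU : size U = (size Ua + size UU)%N by rewrite {1}eU size_cat.
have ecW : nvars UU = nvars W.
  move: ecUV; rewrite eU eV nvars_cat [in RHS]nvars_cat -/UU -/W ec => /addnI ->.
  by rewrite /W nvars_cat nvars_Some.
have sbW : size (consts UU) = size (consts W).
  by rewrite /W consts_cat consts_Some size_cat ssg [consts UU]eUr size_cat ssh.
have sW : size UU = size W by rewrite !size_consts_nvars ecW sbW.
have sVm : size Vm = (size Ua + s)%N by rewrite !size_consts_nvars ec -eb; clear; lia.
have D n : (0 < n < size UU)%N -> (nvars (take n W) < nvars (take n UU))%N.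
  move=> /andP[n_gt0 lt_n]; have [le_n|gt_n] := leqP n s.
    rewrite /W takel_cat ?size_map ?ssg // -map_take nvars_Some.
    by case: n n_gt0 {le_n lt_n} => // n _; rewrite /UU /= consE.
  have := Dn (size Ua + n)%N; rewrite sUU ltn_add2l lt_n addn_gt0 n_gt0 orbT => /(_ isT).
  have -> : nvars (take (size Ua + n) U) = (nvars Ua + nvars (take n UU))%N.
    by rewrite eU takeD take_size_cat // drop_size_cat // nvars_cat.
  have -> : nvars (take (size Ua + n) V) = (nvars Vm + nvars (take (n - s) (Some c :: Vr)))%N.
    have -> : (size Ua + n = size Vm + (n - s))%N.
      by rewrite sVm -addnA subnKC // ltnW.
    by rewrite eV takeD take_size_cat // drop_size_cat // nvars_cat.
  have ns : (n < s)%N = false by apply/negbTE; rewrite -leqNgt ltnW.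
  rewrite ec ltn_add2l /W take_cat size_map ssg ns.
  by rewrite [nvars (map _ _ ++ _)]nvars_cat nvars_Some.
have nsh : ~~ hits st (height_ge f M) 0 sh.
  by move: nb; rewrite eVm hits_cat negb_or et => /andP[_]; rewrite hits_shift.
have hc : M <= foldl st 0 sg + f c.
  by move: le; rewrite fVm foldl_height; clear; lia.
have UU_max : {in var_states st 0 UU, forall h, h <= 0}.
  move=> h h_in; suff : t + h <= t by rewrite gerDl.
  apply: Umax; rewrite eU var_states_cat mem_cat et; apply/orP; right.
  by rewrite -[X in var_states _ X]addr0 var_states_shift; apply: map_f.
have W_max : {in var_states st 0 W, forall h, h <= 0}.
  move=> h; rewrite /W var_states_cat.
  have -> : var_states st 0 (map Some sg) = [::].
    by apply: size0nil; rewrite size_var_states nvars_Some.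
  rewrite consts_Some /= => h_in; suff : t + h <= t by rewrite gerDl.
  apply: Vmax; rewrite eV var_states_cat mem_cat; apply/orP; right; rewrite /= fVm.
  have -> : height f (t + fsum f sg) c = t + height f (foldl st 0 sg) c.
    by rewrite foldl_height /height; clear; lia.
  by rewrite var_states_shift; apply: map_f.
have UU_None : exists U', UU = None :: U' by exists Ur.
have lt_UU : (size UU < size U)%N by rewrite sUU -[X in (X < _)%N]add0n ltn_add2r.
have IHb (E F : seq (option bool)) y1 y2 y3 : (size E <= size UU)%N ->
  consts E = consts F -> E <> F -> subst y1 E = subst y1 F -> subst y2 E = subst y2 F ->
  subst y3 E = subst y3 F -> (0 < size y1 < size y2)%N -> (size y2 < size y3)%N ->
  y1 ++ y2 = y2 ++ y1.
  by move=> leE; apply: IH; apply: leq_ltn_trans leE lt_UU.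
have bW : consts W = sg ++ c :: consts Vr by rewrite /W consts_cat consts_Some.
have eshg : sh = sg := first_block_eq ecW sW UU_None D L1 L2 L3 p12 x1_gt0 lt12 lt23
  eW1 eW2 eW3 UU_max W_max M1 M2 M3 erefl hc eUr bW ssh fsh nsh IHb.
apply: (IH lt_UU _ _ eW1 eW2 eW3); rewrite ?x1_gt0 ?lt12 //.
  by rewrite bW -eshg.
by rewrite /UU /W; case: (sg).
Qed.

End Level.

(** * Commutation of solutions *)

(** The hypothesis makes [y] a prefix of the infinite power of [u]. *)
Lemma period_nth A (u y r r' : seq A) : 0 < size u -> y ++ r = u ++ y ++ r' ->
  forall c i, i < size y -> nth c y i = nth c u (i %% size u).
Proof.
move=> u0 e c i; have [n] := ubnP i; elim: n i => // n IH i lt_n lt_i.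
have : nth c (y ++ r) i = nth c (u ++ y ++ r') i by rewrite e.
rewrite nth_cat lt_i => ->; rewrite nth_cat.
have [lt|le] := ltnP i (size u); first by rewrite modn_small.
rewrite nth_cat (_ : i - size u < size y) ?IH; try by lia.
by rewrite -{2}(subnK le) modnDr.
Qed.

Lemma period_prefix (A : eqType) (u y r r' z q q' : seq A) : 0 < size u ->
  y ++ r = u ++ y ++ r' -> z ++ q = u ++ z ++ q' -> size y <= size z -> prefix y z.
Proof.
move=> u0 ey ez le; rewrite prefixE; apply/eqP.
case: y ey le => [|c y] ey le; first by rewrite take0.
apply: (@eq_from_nth _ c) => [|i]; rewrite size_takel // => lt_i.
rewrite nth_take // (period_nth u0 ey) // (period_nth u0 ez) //.
exact: leq_trans lt_i le.
Qed.

Lemma period_mem (A : eqType) (u y r r' : seq A) : 0 < size u ->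
  y ++ r = u ++ y ++ r' -> {subset y <= u}.
Proof.
move=> u0 e c /(nthP c) [i lt_i <-]; rewrite (period_nth u0 e) // mem_nth //.
by rewrite ltn_mod.
Qed.

Lemma first_var A (V : seq (option A)) : 0 < nvars V ->
  exists u V', V = map Some u ++ None :: V'.
Proof.
elim: V => [//|[c|] V IH]; last by exists [::], V.
by rewrite consE => /IH [u [V' ->]]; exists (c :: u), V'.
Qed.

Lemma first_diff (A : eqType) (u v : seq A) : size u = size v -> u <> v ->
  exists p a b q q', [/\ u = p ++ a :: q, v = p ++ b :: q' & a != b].
Proof.
elim: u v => [|a u IH] [|b v] //= [es] ne.
have [eab|ne_ab] := eqVneq a b; last by exists [::], a, b, u, v.
have [|p [a' [b' [q [q' [eu ev ne']]]]]] := IH v es.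
  by move=> euv; apply: ne; rewrite eab euv.
by exists (a :: p), a', b', q, q'; rewrite eu ev -eab.
Qed.

Definition keep (A : Type) (P : pred A) (U : seq (option A)) :=
  [seq o <- U | if o is Some c then P c else true].

Lemma keep_subst A (P : pred A) y U :
  subst (filter P y) (keep P U) = filter P (subst y U).
Proof.
elim: U => [|[c|] U IH] //=; rewrite ?consE ?filter_cat ?IH //=.
by case: ifP; rewrite ?consE IH.
Qed.

Lemma keep_consts A (P : pred A) U : consts (keep P U) = filter P (consts U).
Proof. by rewrite -!subst_nil -keep_subst. Qed.

Lemma nvars_keep A (P : pred A) U : nvars (keep P U) = nvars U.
Proof. by elim: U => [|[c|] U IH] //=; rewrite ?consE ?IH //; case: ifP; rewrite ?consE. Qed.

Section Indicator.
Local Open Scope ring_scope.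

Lemma fsum_count A (P : pred A) (u : seq A) :
  fsum (fun c => (P c)%:Z) u = (count P u)%:Z.
Proof. by elim: u => [|c u IH]; rewrite ?fsum_cons ?IH // /fsum big_nil. Qed.

Lemma fsum_lin A (f g : A -> int) k l u :
  fsum (fun c => k * f c - l * g c) u = k * fsum f u - l * fsum g u.
Proof. by rewrite /fsum sumrB -!mulr_sumr. Qed.

Lemma var_states_opp A (f : A -> int) h (U : seq (option A)) :
  var_states (height (fun a => - f a)) (- h) U = map -%R (var_states (height f) h U).
Proof.
elim: U h => [|[c|] U IH] h //=; last by rewrite IH.
by rewrite -IH /height opprD.
Qed.

End Indicator.

Lemma leads_label_eq (S : eqType) A B st (g : S -> A -> B) s (U V : seq (option A)) :
  leads U V -> leads (label_eq st g s U) (label_eq st g s V).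
Proof.
case=> eb ec [U' eU] D; split; rewrite ?consts_label_eq ?eb ?nvars_label_eq //.
  by exists (label_eq st g s U'); rewrite eU.
by move=> n; rewrite size_label_eq !label_eq_take !nvars_label_eq => /D.
Qed.

(** [V] does not begin with a variable, as [U] is ahead after one letter. The constants [u] before
    its first variable are a period of every solution. *)
Lemma leads_period A (U V : seq (option A)) : leads U V -> 1 < size U ->
  exists u V' U', [/\ 0 < size u, V = map Some u ++ None :: V' & U = None :: U'].
Proof.
move=> leadsUV sU; have sz := leads_size leadsUV; have [_ ec [U' eU] D] := leadsUV.
have [|u [V' eV]] := @first_var _ V; first by rewrite -ec eU.
exists u, V', U'; split=> //; case: u eV => // eV.
by have := D 1 sU; rewrite eU eV /= !take0 ltnn.
Qed.

Lemma leads_sol_period A (U V : seq (option A)) u V' U' y :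
  V = map Some u ++ None :: V' -> U = None :: U' -> subst y U = subst y V ->
  y ++ subst y U' = u ++ y ++ subst y V'.
Proof. by move=> -> ->; rewrite subst_cat subst_Some !consE. Qed.

Lemma proportional_lt c1 c2 l1 l2 : c1 * l2 = c2 * l1 -> 0 < l1 < l2 ->
  0 < c1 + c2 -> 0 < c1 < c2.
Proof. nia. Qed.

Lemma leads_commute (A : eqType) (U V : seq (option A)) y1 y2 y3 :
  commuting_below (size U) -> leads U V -> 1 < size U ->
  subst y1 U = subst y1 V -> subst y2 U = subst y2 V -> subst y3 U = subst y3 V ->
  0 < size y1 < size y2 -> size y2 < size y3 -> y1 ++ y2 = y2 ++ y1.
Proof.
move=> IH leadsUV sU e1 e2 e3 /andP[y1_gt0 lt12] lt23; apply/eqP/negPn/negP => /eqP ncomm.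
have lt123 : 0 < size y1 < size y2 by rewrite y1_gt0.
have [eb _ _ _] := leadsUV.
have [u [V' [U' [u0 eV eU]]]] := leads_period leadsUV sU.
have per y := @leads_sol_period _ U V u V' U' y eV eU.
have p12 : prefix y1 y2 := period_prefix u0 (per _ e1) (per _ e2) (ltnW lt12).
have p23 : prefix y2 y3 := period_prefix u0 (per _ e2) (per _ e3) (ltnW lt23).
have [|p [a [b [q [q' [ep eq nab]]]]]] := @first_diff _ (y1 ++ y2) (y2 ++ y1) _ ncomm.
  by rewrite !size_cat addnC.
have propP (P : pred A) : count P y1 * size y2 = count P y2 * size y1.
  have := proportional (fun c => (P c)%:Z)%R leadsUV sU e1 e2; rewrite !fsum_count.
  by rewrite -!PoszM => -[].
have occ (d : A) : d \in y1 ++ y2 -> 0 < count_mem d y1.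
  rewrite -has_pred1 has_count count_cat => /(proportional_lt (propP (pred1 d)) lt123).
  by case/andP.
have a_y1 : 0 < count_mem a y1 by apply: occ; rewrite ep mem_cat mem_head orbT.
have b_y1 : 0 < count_mem b y1.
  apply: occ; rewrite mem_cat orbC -mem_cat eq mem_cat mem_head orbT //.
(* This weight vanishes on [y1], hence by proportionality on all solutions; it is positive at [a]
   and negative at [b]. *)
pose f (d : A) : int := ((count_mem b y1)%:Z * (d == a)%:Z - (count_mem a y1)%:Z * (d == b)%:Z)%R.
have f1 : fsum f y1 = 0%R by rewrite fsum_lin !fsum_count mulrC subrr.
have fz y : subst y U = subst y V -> fsum f y = 0%R.
  move=> ey; have := proportional f leadsUV sU e1 ey; rewrite f1 mul0r.
  by move/esym/eqP; rewrite mulf_eq0 => /orP[/eqP //|]; lia.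
have f2 := fz _ e2; have f3 := fz _ e3.
have [leU leV] := level_le0 leadsUV sU y1_gt0 lt12 lt23 p12 p23 f1 f2 f3 e1 e2 e3 IH ncomm.
have fo y : fsum f y = 0%R -> fsum (fun c => - f c)%R y = 0%R.
  by move=> z; rewrite fsum_opp z oppr0.
have [geU geV] := level_le0 leadsUV sU y1_gt0 lt12 lt23 p12 p23 (fo _ f1) (fo _ f2) (fo _ f3) e1 e2 e3 IH ncomm.
have zero (W : seq (option A)) : {in var_states (height f) 0%R W, forall s, (s <= 0)%R} ->
    {in var_states (height (fun c => - f c)%R) 0%R W, forall s, (s <= 0)%R} ->
    {in var_states (height f) 0%R W, forall s, s = 0%R}.
  move=> le ge s s_in; apply/eqP; rewrite eq_le le //= -oppr_le0; apply: ge.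
  by have := var_states_opp f 0%R W; rewrite oppr0 => ->; apply: map_f.
(* Each letter is decorated by the height reached after it; all variables being at height 0,
   solutions stay solutions. *)
pose g (h : int) (d : A) : A * int := (d, h + f d)%R.
pose U2 := label_eq (height f) g 0%R U; pose V2 := label_eq (height f) g 0%R V.
pose w y := labels (height f) g 0%R y.
have leads2 : leads U2 V2 := leads_label_eq (height f) g 0%R leadsUV.
have sU2 : 1 < size U2 by rewrite size_label_eq.
have sol2 y : fsum f y = 0%R -> subst y U = subst y V -> subst (w y) U2 = subst (w y) V2.
  move=> y0 ey; rewrite /U2 /V2 -!(labels_subst (x := y)) ?ey //.
    by move=> t t_in; rewrite (zero V leV geV t t_in) foldl_zero.
  by move=> t t_in; rewrite (zero U leU geU t t_in) foldl_zero.
have s1 := sol2 _ f1 e1; have s2 := sol2 _ f2 e2; have s3 := sol2 _ f3 e3.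
have sw y : size (w y) = size y by rewrite size_labels.
pose h0 := foldl (height f) 0%R p.
pose al := g h0 a; pose be := g h0 b.
have ne_albe : al != be by apply: contraNneq nab => -[->].
have w12 : w y1 ++ w y2 = w p ++ al :: labels (height f) g (height f h0 a) q.
  by rewrite /w -{2}(foldl_zero 0%R f1) -labels_cat ep labels_cat.
have w21 : w y2 ++ w y1 = w p ++ be :: labels (height f) g (height f h0 b) q'.
  by rewrite /w -{2}(foldl_zero 0%R f2) -labels_cat eq labels_cat.
pose P := mem [:: al; be].
have [u2 [V2' [U2' [u20 eV2 eU2]]]] := leads_period leads2 sU2.
have per2 y := @leads_sol_period _ U2 V2 u2 V2' U2' y eV2 eU2.
have sub1 : {subset w y1 <= u2} := period_mem u20 (per2 _ s1).
have sub2 : {subset w y2 <= u2} := period_mem u20 (per2 _ s2).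
have prop2 y y' : subst y U2 = subst y V2 -> subst y' U2 = subst y' V2 ->
    count P y * size y' = count P y' * size y.
  move=> ey ey'; have := proportional (fun c => (P c)%:Z)%R leads2 sU2 ey ey'; rewrite !fsum_count.
  by rewrite -!PoszM => -[].
have c12 : 0 < count P (w y1) < count P (w y2).
  apply: (proportional_lt (prop2 _ _ s1 s2)); rewrite ?sw //.
  by rewrite -count_cat -has_count w12 has_cat /= inE eqxx /= orbT.
have c23 : count P (w y2) < count P (w y3).
  have c2 : 0 < count P (w y2) by case/andP: c12 => ? /(leq_ltn_trans _) ->.
  have l23 : 0 < size (w y2) < size (w y3) by rewrite !sw lt23 andbT (leq_trans _ lt12).
  have := proportional_lt (prop2 _ _ s2 s3) l23; rewrite addn_gt0 c2 => /(_ isT).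
  by case/andP.
(* Erasing a constant outside [P] would leave a shorter equation whose solutions commute by
   induction; yet the erased words still differ at [al] and [be]. *)
have all_P : all P (consts U2).
  apply/negPn/negP => nP.
  have lt_sz : size (keep P U2) < size U.
    have -> : size U = size U2 by rewrite size_label_eq.
    rewrite !size_consts_nvars nvars_keep ltn_add2r keep_consts size_filter.
    by rewrite ltn_neqAle count_size andbT -all_count.
  have ek y : subst y U2 = subst y V2 ->
      subst (filter P y) (keep P U2) = subst (filter P y) (keep P V2).
    by rewrite !keep_subst => ->.
  have kb : consts (keep P U2) = consts (keep P V2).
    by rewrite !keep_consts; case: leads2 => ->.
  have nk : keep P U2 <> keep P V2.
    rewrite eU2 eV2 /= => ekk.
    have : has P u2.
      have : has P (w y1) by rewrite has_count; case/andP: c12.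
      by case/hasP => d d_in Pd; apply/hasP; exists d; rewrite ?sub1.
    have : ohead (keep P (map Some u2 ++ None :: V2')) = Some None by rewrite -ekk.
    by elim: (u2) => //= d u2' IHu; case: ifP.
  have := IH _ _ _ _ _ _ lt_sz kb nk (ek _ s1) (ek _ s2) (ek _ s3).
  rewrite !size_filter c12 c23 => /(_ isT isT).
  rewrite -!filter_cat w12 w21 !filter_cat /= !inE !eqxx /= orbT => /eqP.
  by rewrite eqseq_cat // eqxx /= eqseq_cons (negbTE ne_albe).
(* [p] is not empty, because [y1] is a nonempty prefix of [y2] and both products begin with its
   first letter. *)
case/lastP: p ep eq @h0 @al @be ne_albe w12 w21 @P c12 c23 prop2 all_P => [|p d] ep eq h0 al be _ w12 _ P _ _ _ all_P.
  case: (y1) y1_gt0 p12 ep eq => // c y1' _ /prefixP [r ->] /= [ea _] [eb' _].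
  by move: nab; rewrite -ea -eb' eqxx.
(* The letter before the difference is decorated by [h0], while [al] and [be] carry [h0 + f a] and
   [h0 + f b], which differ from [h0]. *)
have : (d, h0) \in [:: al; be].
  apply: (allP all_P).
  have -> : consts U2 = u2 ++ consts V2' by case: leads2 => -> _ _ _; rewrite eV2 consts_cat consts_Some.
  have : (d, h0) \in w y1 ++ w y2.
    rewrite w12 mem_cat /w -cats1 labels_cat mem_cat /= inE orbC.
    by rewrite /g /h0 -cats1 foldl_cat /= eqxx !orbT.
  by rewrite mem_cat => /orP[/sub1|/sub2]; rewrite mem_cat => ->.
rewrite !inE /al /be /g !xpair_eqE => /orP[] /andP[_ /eqP].
  by rewrite /f eqxx (negbTE nab); lia.
by rewrite /f eqxx eq_sym (negbTE nab); lia.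
Qed.

Lemma nvars_eq_of_sol A (U V : seq (option A)) y : consts U = consts V -> 0 < size y ->
  subst y U = subst y V -> nvars U = nvars V.
Proof.
move=> eb y0 /(congr1 size); rewrite !size_subst eb => /eqP.
by rewrite eqn_add2l eqn_pmul2r // => /eqP.
Qed.

(** A balanced cut gives two shorter equations with the same solutions, and one of them is
    nontrivial. *)
Lemma solutions_commute n : commuting_below n.
Proof.
elim: n => [|n IH] A U V y1 y2 y3 // lt_n eb ne e1 e2 e3 lt12 lt23.
have y1_gt0 : 0 < size y1 by case/andP: lt12.
have IHU : commuting_below (size U).
  move=> B E F z1 z2 z3 lt; apply: IH; move: lt lt_n; clear; lia.
have ec := nvars_eq_of_sol eb y1_gt0 e1; have es : size U = size V by rewrite !size_consts_nvars eb ec.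
have [sU [[m [lt_m cut]]|[leadsUV|leadsVU]]] := leads_cases eb ec ne.
- have [b1 b2 a1 a1'] := cut_equal eb es e1 cut.
  have [_ _ a2 a2'] := cut_equal eb es e2 cut.
  have [_ _ a3 a3'] := cut_equal eb es e3 cut.
  have [et|/eqP nt] := eqVneq (take m U) (take m V).
    apply: (IHU _ _ _ _ _ _ _ b2 _ a1' a2' a3') => //.
      by rewrite size_drop; move: lt_m; clear; lia.
    by move=> ed; apply: ne; rewrite -(cat_take_drop m U) et ed cat_take_drop.
  apply: (IHU _ _ _ _ _ _ _ b1 nt a1 a2 a3) => //.
  by rewrite size_take_min; move: lt_m; clear; lia.
- exact: (leads_commute IHU leadsUV sU e1 e2 e3 lt12 lt23).
rewrite es in IHU sU.
exact: (leads_commute IHU leadsVU sU (esym e1) (esym e2) (esym e3) lt12 lt23).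
Qed.

(** * From four solutions to infinitely many *)

Lemma pump_solutions (A : eqType) (U V : seq (option A)) y1 y2 y3 :
  consts U = consts V -> subst y1 U = subst y1 V -> subst y2 U = subst y2 V ->
  subst y3 U = subst y3 V -> 0 < size y1 < size y2 -> size y2 < size y3 ->
  exists2 x, 0 < size x & forall n, subst (wpow x n) U = subst (wpow x n) V.
Proof.
move=> eb e1 e2 e3 lt12 lt23; have y1_gt0 : 0 < size y1 by case/andP: lt12.
have [->|/eqP ne] := eqVneq U V; first by exists y1.
have comm := solutions_commute (ltnSn (size U)) eb ne e1 e2 e3 lt12 lt23.
have y2_gt0 : 0 < size y2 by case/andP: lt12 => ? /(leq_ltn_trans _) ->.
have [T [a [b [T0 Tp ea eb2]]]] := comm_primitive comm y1_gt0 y2_gt0.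
exists T => //; rewrite ea in e1 lt12 y1_gt0; rewrite eb2 in e2 lt12 y2_gt0.
rewrite !size_wpow in lt12 y1_gt0 y2_gt0.
have a0 : 0 < a by move: y1_gt0; rewrite muln_gt0 => /andP[].
have b0 : 0 < b by move: y2_gt0; rewrite muln_gt0 => /andP[].
apply: (pump T0 Tp _ a0 b0 eb _ e1 e2).
  by apply/eqP => eab; move: lt12; rewrite eab ltnn andbF.
by apply: nvars_eq_of_sol eb _ e1; rewrite size_wpow.
Qed.

Definition pumpable (A : Type) (U V : seq (option A)) := exists y0 x,
  0 < size x /\ forall n, subst (y0 ++ wpow x n) U = subst (y0 ++ wpow x n) V.

Lemma pumpable_sym A (U V : seq (option A)) : pumpable U V -> pumpable V U.
Proof. by move=> [y0 [x [x0 h]]]; exists y0, x; split=> // n; rewrite h. Qed.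

Lemma pumpable_head (A : eqType) (U' V' : seq (option A)) a (ys : seq (seq A)) :
  uniq ys -> size ys = 4 ->
  {in ys, forall y, subst y (None :: U') = subst y (Some a :: V')} ->
  pumpable (None :: U') (Some a :: V').
Proof.
move=> uys sys; set U := None :: U'; set V := Some a :: V' => sol.
(* Without a variable, [V] has a fixed image, which determines the length of a solution and then the
   solution, as a prefix of that image. *)
have [cV|cV] := posnP (nvars V).
  exfalso; case: ys uys sys sol => [|y [|z ys]] //= /and3P[yz _ _] _ sol.
  have ey := sol y (mem_head _ _); have ez : subst z U = subst z V.
    by apply: sol; rewrite !inE eqxx orbT.
  have constV w : subst w V = consts V.
    have : nvars V = 0 by []; elim: (V) => [|[c|] W IHW] //; rewrite !consE // => /IHW ->.
    by [].
  have es : size y = size z.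
    have := congr1 size ey; have := congr1 size ez; rewrite !constV => <- /eqP.
    by rewrite !size_subst eqn_add2l eqn_pmul2l // => /eqP.
  have : y ++ subst y U' = z ++ subst z U' by rewrite -!subst_consN -/U ey ez !constV.
  by case/(cat_inv es) => eyz _; move: yz; rewrite eyz inE eqxx.
have [u [V'' eV]] := first_var cV.
have u0 : 0 < size u by case: (u) eV.
have per y : y \in ys -> y ++ subst y U' = u ++ y ++ subst y V''.
  by move=> /sol e; apply: leads_sol_period eV erefl e.
have pre y z : y \in ys -> z \in ys -> size y <= size z -> prefix y z.
  by move=> /per ey /per ez; apply: period_prefix u0 ey ez.
pose leS := fun y z : seq A => size y <= size z.
have tot : total leS by move=> y z; apply: leq_total.
have srt := sort_sorted tot ys; have pm : perm_eq (sort leS ys) ys by rewrite perm_sort.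
have mem_s y : y \in sort leS ys = (y \in ys) by rewrite mem_sort.
move: srt (perm_size pm) (perm_uniq pm) mem_s; rewrite sys uys.
case: (sort leS ys) => [|y0 [|y1 [|y2 [|y3 []]]]] //= /and4P[l01 l12 l23 _] _ uq mem_s.
have in0 : y0 \in ys by rewrite -mem_s !inE eqxx.
have in1 : y1 \in ys by rewrite -mem_s !inE eqxx orbT.
have in2 : y2 \in ys by rewrite -mem_s !inE eqxx !orbT.
have in3 : y3 \in ys by rewrite -mem_s !inE eqxx !orbT.
have strict y z : y \in ys -> z \in ys -> y != z -> size y <= size z -> size y < size z.
  move=> y_in z_in nyz le; rewrite ltn_neqAle le andbT; apply: contraNneq nyz => es.
  by have := pre y z y_in z_in le; rewrite prefixE es take_size eq_sym.
move: uq; rewrite !inE !negb_or => /and4P[/and3P[n01 n02 n03] /andP[n12 n13] n23 _].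
have s01 := strict _ _ in0 in1 n01 l01; have s12 := strict _ _ in1 in2 n12 l12.
have s23 := strict _ _ in2 in3 n23 l23.
(* Removing the shortest solution [y0] from the front of the three others leaves words of increasing
   positive lengths, to which [pump_solutions] applies after shifting. *)
have [x1 e1] := prefixP (pre _ _ in0 in1 l01).
have [x2 e2] := prefixP (pre _ _ in0 in2 (ltnW (ltn_trans s01 s12))).
have [x3 e3] := prefixP (pre _ _ in0 in3 (ltnW (ltn_trans s01 (ltn_trans s12 s23)))).
have sh x : y0 ++ x \in ys ->
    subst x (shift_var y0 U) = subst x (shift_var y0 V).
  by move=> x_in; rewrite !subst_shift sol.
rewrite e1 in s01 s12 in1; rewrite e2 in s12 s23 in2; rewrite e3 in s23 in3.
rewrite !size_cat in s01 s12 s23.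
have [|||x x0 hx] := @pump_solutions _ (shift_var y0 U) (shift_var y0 V) x1 x2 x3 _
  (sh _ in1) (sh _ in2) (sh _ in3).
- by rewrite -!subst_nil; apply: sh; rewrite cats0.
- by move: s01 s12; clear; lia.
- by move: s23; clear; lia.
by exists y0, x; split=> // n; rewrite -!subst_shift.
Qed.

(** Common first letters are cancelled. Heads that differ must be a variable and a constant, since
    two different constants allow no solution. *)
Lemma four_solutions (A : eqType) (U V : seq (option A)) (ys : seq (seq A)) :
  uniq ys -> size ys = 4 -> {in ys, forall y, subst y U = subst y V} -> pumpable U V.
Proof.
move=> uys sys.
have nil_cons o W : {in ys, forall y, subst y [::] = subst y (o :: W)} -> pumpable [::] (o :: W).
  move=> sol; exfalso; case: ys uys sys sol => [|y [|z ys]] //= /and3P[yz _ _] _ sol.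
  case: o sol => [c|] sol; first by have := sol y (mem_head _ _); rewrite consE.
  have y0 : y = [::] by have := sol y (mem_head _ _); rewrite consE; case: (y).
  have z0 : z = [::].
    by have := sol z; rewrite !inE eqxx orbT consE => /(_ isT); case: (z).
  by move: yz; rewrite y0 z0.
elim: U V => [|o U IH] [|o' V] sol.
- case: ys uys sys {sol nil_cons} => [|y [|z ys]] //= /and3P[yz _ _] _.
  (* Every word is a solution here; of two distinct words one is nonempty. *)
  by exists [::], (if y is [::] then z else y); split=> //; case: y yz => //; case: z.
- exact: nil_cons.
- by apply: pumpable_sym; apply: nil_cons => y /sol.
have [eo|no] := eqVneq o o'.
  subst o'; have [|y0 [x [x0 h]]] := IH V.
    by move=> y /sol; rewrite !subst_cons => /cat_inv -[].
  by exists y0, x; split=> // n; rewrite !subst_cons h.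
case: o o' no sol => [a|] [b|] // nab sol.
- exfalso; case: ys uys sys sol {IH nil_cons} => // y ys _ _ /(_ y (mem_head _ _)).
  by rewrite !consE => -[eab _]; move: nab; rewrite eab eqxx.
- by apply: pumpable_sym; apply: pumpable_head uys sys _ => y /sol.
exact: pumpable_head uys sys _.
Qed.

(** * Counting solutions as morphisms *)

Lemma morph_subst (Gamma : Type) (h : seq (letter Gamma) -> seq Gamma) :
  monoid_morph h -> constant_preserving h -> h = subst (h [:: None]).
Proof.
move=> [h0 hM] hc; apply/funext; elim=> [|o u IH]; first by rewrite h0.
by rewrite -cat1s hM IH subst_cat; case: o => [a|] //=; rewrite ?hc // subst_cons /= cats0.
Qed.

Lemma subst_solution (Gamma : Type) (E : word_equation Gamma) x :
  subst x E.1 = subst x E.2 -> solutions E (subst x).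
Proof. by split=> //; split=> // u v; apply: subst_cat. Qed.

Lemma card_seq_le (T : eqType) (s : seq T) n :
  size s <= n -> ([set` s] #<= `I_n)%card.
Proof.
case: s => [|x s] le_n; first by rewrite set_nil; apply: card_ge0.
apply: (card_le_trans _ (card_image_le (nth x (x :: s)) _)).
apply: subset_card_le => y /= ys; exists (index y (x :: s)); last exact: nth_index.
by apply: leq_trans le_n; rewrite index_mem.
Qed.

Local Open Scope classical_set_scope.
Local Open Scope card_scope.

Theorem theorem25 (Gamma : Type) (E : word_equation Gamma) :
  finite_set (solutions E) -> solutions E #<= `I_3.
Proof.
(* The lemmas on words ask for decidable equality of letters, which is supplied classically. *)
move=> finS; pose G : eqType := {classic Gamma}.
pose at_var (h : seq (letter Gamma) -> seq Gamma) : seq G := h [:: None].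
have at_subst (x : seq G) : at_var (subst x) = x by rewrite /at_var subst_cons cats0.
have substK h : solutions E h -> subst (at_var h) = h.
  by case=> hm hc _; rewrite -morph_subst.
have inj : {in solutions E &, injective at_var}.
  by move=> h k /set_mem /substK hE /set_mem /substK kE ehk; rewrite -hE ehk.
rewrite -(card_le_eql (inj_card_eq inj)).
have /finite_seqP[s Ws] : finite_set (at_var @` solutions E) by apply: finite_image.
have {}Ws : at_var @` solutions E = [set` undup s].
  by rewrite Ws; apply/seteqP; split=> y /=; rewrite mem_undup.
rewrite Ws; apply: card_seq_le; rewrite leqNgt; apply/negP => s4.
have sol : {in take 4 (undup s), forall y : seq G, subst y E.1 = subst y E.2}.
  move=> y /mem_take ys; have : (at_var @` solutions E) y by rewrite Ws.
  by case=> h hS <-; rewrite substK //; case: hS.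
have [y0 [x [x0 hx]]] : @pumpable G E.1 E.2.
  by apply: four_solutions sol; rewrite ?take_uniq ?undup_uniq // size_takel.
(* The exponent exceeds the length of every solution, so [y0 ++ wpow x n] is too long to be in the
   finite list. *)
pose n := (\max_(y <- undup s) size y).+1.
have : (at_var @` solutions E) (y0 ++ wpow x n).
  exists (subst (y0 ++ wpow x n)); last exact: at_subst.
  exact: subst_solution.
rewrite Ws /= => y_in; have := leq_bigmax_seq (P := predT) (F := size) _ y_in isT;
  rewrite size_cat size_wpow.
by rewrite leqNgt ltn_addl // leq_pmulr.
Qed.
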